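(* Consider the random triangle removal process on $n$ vertices, let $C>0$ be an absolute constant and let $\tau_\star$ be as defined in the context. For every $L>0$ there is some $0<\delta<1$ such that with high probability, for all $t\le\tau_\star$, every extension graph $H$ on $v_H\le L$ vertices and every injection $\varphi: I_H\to V_G$: (i) if $H$ is balanced then $|\Psi_{H,\varphi}-\mathcal S_H|\le \mathcal S_H\,\zeta^{\delta}$ for all $t\le t^-_H(\sqrt\delta)$; (ii) if $H$ is strictly balanced then $|\Psi_{H,\varphi}-\mathcal S_H|\le (\mathcal S_H)^{1-\sqrt\delta}(\log n)^{\rho}$ with $\rho=3e^{v_H-\iota_H}$, for all $t$ with $t^-_H(\sqrt\delta)\le t\le t_H$.
   Context: Random triangle removal process: $G(0)=K_n$ on vertex set $V_G$, $|V_G|=n$; as long as $G(i)$ has a triangle, $G(i+1)$ is obtained by deleting the three edges of a uniformly random triangle of $G(i)$. Let $t=i/n^2$, $p=p(t)=1-6t$; all times are of the form $i/n^2$. $Y_u$ denotes the degree of $u$ in $G(i)$, $Y_{u,v}$ the co-degree of distinct $u,v$, $Q$ the number of triangles, and $\zeta=n^{-1/2}p^{-1}\log n$. $\tau_\star$ is the minimal $t>0$ at which one of the following fails: $|Y_u/(np)-1|<C\zeta$ for all $u$; $|Y_{u,v}/(np^2)-1|<C\zeta$ for all $u\ne v$; $|Q/(\frac16n^3p^3)-1|<C\zeta^2$; or the standing requirement that $p(t)$ is such that $\log(1/\zeta)/\log\log n\to\infty$. An extension graph is a graph $H=(V_H,E_H)$ with a set $I_H\subseteq V_H$ of distinguished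 vertices forming an independent set; $e_H=|E_H|$, $v_H=|V_H|$, $\iota_H=|I_H|$. Its scaling is $\mathcal S_H=\mathcal S_H(n,p)=n^{v_H-\iota_H}p^{e_H}$ and its density is $m_H=e_H/(v_H-\iota_H)$. A subextension $K\subset H$ is an extension graph with $V_K\subseteq V_H$, $E_K\subseteq E_H$ and $I_K=I_H$. $H$ is balanced if $m_H\ge m_K$ for every subextension $K$, and strictly balanced if $m_H>m_K$ for every subextension $K$ with $E_K\subsetneq E_H$. For an injection $\varphi:I_H\to V_G$, $\Psi_{H,\varphi}$ is the number of injective maps $\psi:V_H\to V_G$ with $\psi|_{I_H}=\varphi$ and $\psi(a)\psi(b)\in E(G(i))$ for all $ab\in E_H$. Define $t_H=\min\{t:\mathcal S_H(n,p(t))\le 1\}$ and, for $r\ge0$, $t^-_H(r)=\min\{t:\mathcal S_H(n,p(t))\le \zeta^{-r}\}$. ''With high probability'' means with probability tending to $1$ as $n\to\infty$. *)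

(* Defs.v *)
From HB Require Import structures.
From mathcomp Require Import all_boot all_order all_algebra.
From mathcomp Require Import all_classical all_reals all_analysis.
Set Implicit Arguments. Unset Strict Implicit. Unset Printing Implicit Defensive.
Import Order.TTheory GRing.Theory Num.Theory.
Import numFieldNormedType.Exports.
Local Open Scope ring_scope.

(* ---------- Graphs on V_G = 'I_n : a graph is its set of edges (2-sets). *)
Definition graph (n : nat) := {set {set 'I_n}}.

Definition complete_graph (n : nat) : graph n := [set e : {set 'I_n} | #|e| == 2%N].

Definition triangles n (G : graph n) : {set {set 'I_n}} :=
  [set T : {set 'I_n} | (#|T| == 3%N) &&
     [forall e : {set 'I_n}, ((e \subset T) && (#|e| == 2%N)) ==> (e \in G)]].

Definition remove_triangle n (G : graph n) (T : {set 'I_n}) : graph n :=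
  G :\: [set e : {set 'I_n} | (e \subset T) && (#|e| == 2%N)].

Definition deg n (G : graph n) (u : 'I_n) : nat := #|[set w | [set u; w] \in G]|.
Definition codeg n (G : graph n) (u v : 'I_n) : nat :=
  #|[set w | ([set u; w] \in G) && ([set v; w] \in G)]|.
Definition numtri n (G : graph n) : nat := #|triangles G|.

(* ---------- The random triangle removal process.
   traj_prob G k E = probability that the trajectory [:: G(0); ...; G(k)] of the
   process started at G(0) = G satisfies the event E.  Once the graph is
   triangle-free the process stops; we then continue it as constant, which does
   not affect any event concerning G(i) for i up to the stopping step. *)
Fixpoint traj_prob {R : realType} n (G : graph n) (k : nat)
    (E : seq (graph n) -> Prop) : R :=
  match k with
  | 0%N => if `[< E [:: G] >] then 1 else 0
  | k'.+1 =>
      if triangles G == finset.set0 then traj_prob G k' (fun s => E (G :: s))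
      else (#|triangles G|%:R)^-1 *
           \sum_(T in triangles G)
              traj_prob (remove_triangle G T) k' (fun s => E (G :: s))
  end.

Definition Prob {R : realType} (n : nat) (E : seq (graph n) -> Prop) : R :=
  traj_prob (complete_graph n) (n ^ 2)%N E.

Section Time.
Variables (R : realType) (n : nat).
Definition time (i : nat) : R := i%:R / (n%:R ^+ 2).
Definition pp (i : nat) : R := 1 - 6 * time i.
Definition zeta (i : nat) : R := ln (n%:R) / (Num.sqrt (n%:R) * pp i).
End Time.

Definition is_ext (v : nat) (EH : {set {set 'I_v}}) (IH : {set 'I_v}) : Prop :=
  (forall e, e \in EH -> #|e| = 2%N) /\ (forall e, e \in EH -> ~~ (e \subset IH)).

Definition is_subext (v : nat) (EH : {set {set 'I_v}}) (IH : {set 'I_v})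
    (VK : {set 'I_v}) (EK : {set {set 'I_v}}) : Prop :=
  IH \subset VK /\ EK \subset EH /\ (forall e, e \in EK -> e \subset VK).

Definition density {R : realType} (nv : nat) (ne : nat) (iota : nat) : R :=
  ne%:R / (nv - iota)%N%:R.

Definition balanced {R : realType} v (EH : {set {set 'I_v}}) (IH : {set 'I_v}) : Prop :=
  forall VK EK, is_subext EH IH VK EK ->
    density (R := R) #|VK| #|EK| #|IH| <= density (R := R) v #|EH| #|IH|.

Definition strictly_balanced {R : realType} v (EH : {set {set 'I_v}}) (IH : {set 'I_v})
  : Prop :=
  forall VK EK, is_subext EH IH VK EK -> EK != EH ->
    density (R := R) #|VK| #|EK| #|IH| < density (R := R) v #|EH| #|IH|.

Definition scaling {R : realType} n v (EH : {set {set 'I_v}}) (IH : {set 'I_v})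
    (i : nat) : R :=
  n%:R ^+ (v - #|IH|)%N * pp R n i ^+ #|EH|.

Definition Psi n v (EH : {set {set 'I_v}}) (IH : {set 'I_v}) (phi : 'I_v -> 'I_n)
    (G : graph n) : nat :=
  #|[set psi : {ffun 'I_v -> 'I_n} | [&& injectiveb psi,
        [forall a in IH, psi a == phi a] &
        [forall e in EH, (psi @: e) \in G]]]|.

(* For a property P of (discrete) times j (j = step, time j/n^2), with
   t_P := min { j : P j } (= +infinity if the set is empty):
   "i <= t_P"  <->  no j < i satisfies P;
   "t_P <= i"  <->  some j <= i satisfies P. *)
Definition le_tmin (i : nat) (P : nat -> Prop) : Prop := forall j, (j < i)%N -> ~ P j.
Definition ge_tmin (i : nat) (P : nat -> Prop) : Prop := exists j, (j <= i)%N /\ P j.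

(* The conditions whose first failure (at a time t > 0) defines tau_star.
   omega encodes the standing requirement  log(1/zeta)/loglog n -> infinity
   as  log(1/zeta)/loglog n >= omega n  with omega n -> +infinity. *)
Definition good {R : realType} (C : R) (omega : nat -> R) n (G : graph n) (i : nat)
  : Prop :=
  let p := pp R n i in let z := zeta R n i in
  [/\ forall u : 'I_n, `| (deg G u)%:R / (n%:R * p) - 1 | < C * z,
      forall u v : 'I_n, u != v ->
         `| (codeg G u v)%:R / (n%:R * p ^+ 2) - 1 | < C * z,
      `| (numtri G)%:R / (6^-1 * n%:R ^+ 3 * p ^+ 3) - 1 | < C * z ^+ 2 &
      0 < p /\ omega n <= ln (z^-1) / ln (ln n%:R)].

(* "t_i <= tau_star": all times j/n^2 with 0 < j < i are good *)
Definition before_tau {R : realType} (C : R) (omega : nat -> R) n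
    (s : seq (graph n)) (i : nat) : Prop :=
  forall j, (0 < j)%N -> (j < i)%N -> good C omega (nth (complete_graph n) s j) j.

Local Open Scope classical_set_scope.
Definition whp {R : realType} (E : forall n : nat, seq (graph n) -> Prop) : Prop :=
  (fun n : nat => @Prob R n (E n)) @ \oo --> (1 : R).

(* Main.v *)
(** Write [x = 6 / (n^2 p)], so that [p] shrinks by exactly the factor [1 - x] in
    one step and [sum x zeta] telescopes to [O(zeta)].  While co-degrees and the
    number of triangles are under control, a fixed set [F] of edges is hit in one
    step with probability [x (|F| + O(zeta) (|F| + |F|^2))].

    Hence [P(F in G(i)) <= O(1) p^|F|] for [|F|] polylogarithmic, and the
    moments of order [~ log n] of an extension count are at most those in the
    binomial random graph.  This bounds the number of extensions through a given
    edge by [polylog(n) S_H / min_W S_(H[W])], [W] ranging over the vertex sets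
    which contain the roots and an edge.

    On the other hand [Psi / S_H] is a martingale up to a factor [1 + O(x zeta)].
    Since its jumps are bounded by the previous count,
    [exp(+- lam Psi / S_H)] is a supermartingale once [lam] is slowly tilted with
    time, which concentrates [Psi / S_H] around [1] as soon as
    [min_W S_(H[W])] beats the target precision; (strict) balancedness is used
    only to bound this minimum from below. *)

Require Import Defs.
From HB Require Import structures.
From mathcomp Require Import all_boot all_order all_algebra.
From mathcomp Require Import all_classical all_reals all_analysis.
From mathcomp Require Import ring lra.
Import Order.TTheory GRing.Theory Num.Theory.
Import numFieldNormedType.Exports.
Local Open Scope ring_scope.
Set Implicit Arguments. Unset Strict Implicit. Unset Printing Implicit Defensive.

(** * Trajectories of the process *)

Section Trajectories.
Variable R : realType.
Implicit Types (n k : nat).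

(** The obstacle is that a jump of [Psi] is controlled by counts of extensions whose root set
    contains one more edge of [H], and these need not be balanced. Only an upper bound on them is
    required, but for every root set and every placement of it, so a high moment does the work of an
    induction over extensions. The union bound runs over a constant times [n ^ (N + 2)] instances:
    times, shapes on at most [N] vertices, placements of the roots. Each failure must therefore have
    probability [O(n ^ -(N + 4))]. This fixes the order of the moments at about [(N + 4) * ln n], so
    they involve sets of [O(ln n)] edges; their error term is quadratic in the number of edges and
    forces [zeta * (ln n) ^ 2] to be small. Such losses are affordable because the growth of [omega]
    puts [zeta] below any fixed negative power of [ln n]. In (ii) the scaling may come down to about
    [1], where the permitted relative error exceeds [1]; hence the minimum of [eps] and [1] in the
    conditions below. *)

Lemma mean_le (T : finType) (A : {set T}) (f : T -> R) (b : R) :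
  (0 < #|A|)%N -> (forall t, t \in A -> f t <= b) ->
  (#|A|%:R)^-1 * \sum_(t in A) f t <= b.
Proof.
move=> A0 fb; rewrite mulrC ler_pdivrMr ?ltr0n //.
apply: (@le_trans _ _ (\sum_(t in A) b)); first exact: ler_sum.
by rewrite sumr_const mulr_natr.
Qed.

Lemma traj_prob_ge0 n (G : graph n) k E : 0 <= traj_prob (R := R) G k E.
Proof.
elim: k G E => [|k IH] G E /=; first by case: ifP.
case: ifP => _ //; rewrite mulr_ge0 ?invr_ge0 ?ler0n //.
by apply: sumr_ge0 => T _.
Qed.

Lemma traj_prob_mono n (G : graph n) k (E1 E2 : seq (graph n) -> Prop) :
  (forall s, E1 (G :: s) -> E2 (G :: s)) ->
  traj_prob (R := R) G k E1 <= traj_prob G k E2.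
Proof.
elim: k G E1 E2 => [|k IH] G E1 E2 E12 /=.
  case: (asboolP (E1 _)) => e1; case: (asboolP (E2 _)) => e2 //.
  by case: e2; exact: E12.
case: ifP => _; first by apply: IH => s; exact: E12.
rewrite ler_wpM2l ?invr_ge0 ?ler0n //.
by apply: ler_sum => T _; apply: IH => s; exact: E12.
Qed.

Lemma traj_prob_or n (G : graph n) k (E1 E2 : seq (graph n) -> Prop) :
  traj_prob (R := R) G k (fun s => E1 s \/ E2 s) <=
  traj_prob G k E1 + traj_prob G k E2.
Proof.
elim: k G E1 E2 => [|k IH] G E1 E2 /=.
  case: (asboolP (_ \/ _)) => h; case: (asboolP (E1 _)) => h1;
    case: (asboolP (E2 _)) => h2; try lra; tauto.
case: ifP => _; first exact: IH.
rewrite -mulrDr -big_split /= ler_wpM2l ?invr_ge0 ?ler0n //.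
by apply: ler_sum => T _; exact: IH.
Qed.

Lemma traj_probT n (G : graph n) k (E : seq (graph n) -> Prop) :
  (forall s, E (G :: s)) -> traj_prob (R := R) G k E = 1.
Proof.
elim: k G E => [|k IH] G E ET /=; first by rewrite asboolT.
case: ifPn => T0; first by apply: IH => s.
rewrite (eq_bigr (fun=> 1)) => [|T _]; last by apply: IH => s.
by rewrite sumr_const mulVf // pnatr_eq0 cards_eq0.
Qed.

Lemma traj_prob_le1 n (G : graph n) k E : traj_prob (R := R) G k E <= 1.
Proof. by rewrite -(@traj_probT n G k (fun=> True)) //; exact: traj_prob_mono. Qed.

Lemma traj_prob0 n (G : graph n) k (E : seq (graph n) -> Prop) :
  (forall s, ~ E (G :: s)) -> traj_prob (R := R) G k E = 0.
Proof.
move=> E0; apply/eqP; rewrite eq_le traj_prob_ge0 andbT.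
have : traj_prob (R := R) G k (fun=> True) = 1 by apply: (@traj_probT n G k (fun=> True)).
elim: k G E E0 => [|k IH] G E E0 /= => [_|]; first by rewrite asboolF.
case: ifPn => T0 _; first by apply: IH => //; apply: (@traj_probT n G k (fun=> True)).
apply: mean_le; first by rewrite card_gt0.
move=> T _; apply: IH => [s|]; first exact: E0.
by apply: (@traj_probT n _ k (fun=> True)).
Qed.

Lemma traj_prob_exists n (G : graph n) k (T : finType)
    (E : T -> seq (graph n) -> Prop) (b : R) :
  (forall x, traj_prob G k (E x) <= b) ->
  traj_prob G k (fun s => exists x, E x s) <= #|T|%:R * b.
Proof.
move=> Eb.
have H (r : seq T) : traj_prob G k (fun s => exists2 x, x \in r & E x s)
    <= (size r)%:R * b.
  elim: r => [|x r IH] /=; first by rewrite mul0r traj_prob0 // => s [].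
  rewrite -natr1 mulrDl mul1r addrC; apply: le_trans (lerD (Eb x) IH).
  apply: le_trans (traj_prob_or _ _ _ _); apply: traj_prob_mono => s [y].
  by rewrite inE => /orP[/eqP->|yr] Ey; [left | right; exists y].
rewrite cardE; apply: le_trans (H _); apply: traj_prob_mono => s [x Ex].
by exists x; rewrite ?mem_enum.
Qed.

Lemma remove_triangle_sub n (G : graph n) T : remove_triangle G T \subset G.
Proof. exact: subsetDl. Qed.

(* Ville's maximal inequality for a function of time and the current graph which
   is a supermartingale as long as [A] holds. *)
Section Ville.
Variables (n : nat) (f : nat -> graph n -> R) (A : nat -> graph n -> Prop).
Variables (a : R) (m : nat).
Hypothesis a0 : 0 < a.
Hypothesis f0 : forall i G, (i <= m)%N -> 0 <= f i G.
Hypothesis f_step : forall i (G : graph n), (i < m)%N ->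
  G \subset complete_graph n -> A i G -> (0 < numtri G)%N /\
  (#|triangles G|%:R)^-1 * \sum_(T in triangles G) f i.+1 (remove_triangle G T)
  <= f i G.

(** Induction on the number of steps left, with the starting time and graph free. The event demands
    [A] at all earlier steps, so it is empty from a graph where [A] fails; this takes the place of
    stopping the process. *)
Let ville_from k (G : graph n) i0 i :
  (i <= k)%N -> (i0 + i)%N = m -> G \subset complete_graph n ->
  traj_prob G k (fun s =>
    (forall j, (j < i)%N -> A (i0 + j) (nth (complete_graph n) s j)) /\
    a <= f m (nth (complete_graph n) s i)) <= f i0 G / a.
Proof.
elim: k G i0 i => [|k IH] G i0 [|i] // ik im GK.
- rewrite addn0 in im; rewrite /= im; case: asboolP => [[_ af]|_].
    by rewrite ler_pdivlMr // mul1r.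
  by rewrite divr_ge0 ?f0 // ltW.
- rewrite addn0 in im; rewrite im; have [af|af] := boolP (a <= f m G).
    by apply: (le_trans (traj_prob_le1 _ _ _)); rewrite ler_pdivlMr // mul1r.
  rewrite traj_prob0 ?divr_ge0 ?f0 // ?(ltW a0) // => s [_] /=.
  by rewrite (negbTE af).
have i0m : (i0 < m)%N by rewrite -im addnS ltnS leq_addr.
have [Ai|nA] := pselect (A i0 G); last first.
  rewrite traj_prob0 ?divr_ge0 ?f0 // ?(ltW a0) // 1?ltnW //.
  by move=> s [/(_ 0%N isT)] /=; rewrite addn0.
have [T0 fs] := f_step i0m GK Ai; rewrite /numtri in T0.
have T0' : triangles G != finset.set0 by rewrite -card_gt0.
rewrite /= (negbTE T0') ler_pdivrMl ?ltr0n //.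
apply: (@le_trans _ _ (\sum_(T in triangles G) f i0.+1 (remove_triangle G T) / a)).
  apply: ler_sum => T _; apply: le_trans (IH _ i0.+1 i _ _ _).
  - apply: traj_prob_mono => s /= [Aj af].
    split=> // j ji; have := Aj j.+1 ji; by rewrite addSnnS.
  - by [].
  - by rewrite addSnnS.
  - exact: (fintype.subset_trans (remove_triangle_sub _ _)).
rewrite -big_distrl /= mulrA ler_pM2r ?invr_gt0 //.
by rewrite -ler_pdivrMl ?ltr0n.
Qed.

Lemma ville : (m <= n ^ 2)%N ->
  Prob (fun s : seq (graph n) =>
    (forall j, (j < m)%N -> A j (nth (complete_graph n) s j)) /\
    a <= f m (nth (complete_graph n) s m)) <= f 0 (complete_graph n) / a.
Proof. by move=> mn; apply: (@ville_from _ _ 0%N m). Qed.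

End Ville.
End Trajectories.

(** * Edges hit by one random triangle *)

Section TriangleCounts.
Variable n : nat.
Implicit Types (G F : graph n) (T e f : {set 'I_n}).

Definition hits F T : bool := [exists f in F, f \subset T].

Definition hit_count G F : nat := #|[set T in triangles G | hits F T]|.

Lemma sub_remove_triangle F G T : F \subset complete_graph n ->
  (F \subset remove_triangle G T) = (F \subset G) && ~~ hits F T.
Proof.
move=> FK; rewrite /remove_triangle subsetD; congr andb.
rewrite disjoint_subset; apply/fintype.subsetP/idP => [sF|hF f fF].
  apply/negP => /existsP[f /andP[fF fT]]; have := sF _ fF.
  by have := fintype.subsetP FK _ fF; rewrite !inE fT /= => ->.
have := fintype.subsetP FK _ fF; rewrite !inE => ->; rewrite andbT.
by apply: contra hF => fT; apply/existsP; exists f; rewrite fF.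
Qed.

Lemma set3_sub2 (u v w : 'I_n) e : u != v -> u != w -> v != w ->
  e \subset [set u; v; w] -> #|e| = 2%N ->
  [\/ e = [set u; v], e = [set u; w] | e = [set v; w]].
Proof.
move=> uv uw vw /fintype.subsetP se /eqP/cards2P[a [b [ab ee]]].
move: (se a) (se b); rewrite ee !inE !eqxx ?orbT => /(_ isT) ha /(_ isT) hb.
have sym (x y : 'I_n) : [set x; y] = [set y; x] by rewrite finset.setUC.
move: ha hb ab => /orP[/orP[]|] /eqP-> /orP[/orP[]|] /eqP->; rewrite ?eqxx // => _;
 first [by constructor 1 | by constructor 2 | by constructor 3
  | by constructor 1; rewrite sym | by constructor 2; rewrite sym
  | by constructor 3; rewrite sym].
Qed.

Lemma card_triangles_edge G (u v : 'I_n) :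
  G \subset complete_graph n -> u != v -> [set u; v] \in G ->
  #|[set T in triangles G | [set u; v] \subset T]| = codeg G u v.
Proof.
move=> GK uv uvG; rewrite /codeg.
(* For [w = u] the set [[set u; w]] is a singleton, hence not an edge; so common neighbours are
   automatically distinct from [u] and [v]. *)
have nw w : [set u; w] \in G -> [set v; w] \in G -> (u != w) && (v != w).
  move=> /(fintype.subsetP GK) + /(fintype.subsetP GK).
  by rewrite !inE !cards2; do 2 case: (_ != _).
rewrite -(@card_in_imset _ _ (fun w => [set u; v; w])) => [|w w']; last first.
  rewrite !inE => /andP[uw vw] /andP[uw' vw'].
  have /andP[h1 h2] := nw _ uw vw; have /andP[h3 h4] := nw _ uw' vw'.
  move=> /setP /(_ w); rewrite !inE eqxx orbT.
  by rewrite (eq_sym w u) (eq_sym w v) (negbTE h1) (negbTE h2) /= => /esym/eqP.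
apply: eq_card => T; rewrite inE; apply/idP/imsetP => [|[w wP ->]].
  move=> /andP[]; rewrite inE => /andP[/eqP T3 /forallP TG] uvT.
  have : #|T :\: [set u; v]| = 1%N.
    by rewrite cardsD (finset.setIidPr uvT) T3 cards2 uv.
  move=> /eqP/cards1P[w Tw].
  have TE : T = [set u; v; w] by rewrite -(finset.setID T [set u; v]) (finset.setIidPr uvT) Tw.
  have : w \in T :\: [set u; v] by rewrite Tw inE.
  rewrite !inE negb_or -andbA => /and3P[wu wv wT].
  exists w => //; rewrite inE.
  have := TG [set u; w]; have := TG [set v; w].
  rewrite !cards2 (eq_sym u w) wu (eq_sym v w) wv !andbT TE.
  by rewrite !finset.subUset !finset.sub1set !inE !eqxx ?orbT /= => -> ->.
move: wP; rewrite inE => /andP[uw vw]; have /andP[h1 h2] := nw _ uw vw.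
rewrite inE -andbA; apply/and3P; split.
- by rewrite finset.setUC cardsU1 !inE negb_or (eq_sym w u) h1 (eq_sym w v) h2 cards2 uv.
- apply/forallP => e; apply/implyP => /andP[eT /eqP e2].
  by case: (set3_sub2 uv h1 h2 eT e2) => ->.
- exact: finset.subsetUl.
Qed.

Lemma card_triangles_two_edges G f f' : #|f| = 2%N -> #|f'| = 2%N -> f != f' ->
  (#|[set T in triangles G | (f \subset T) && (f' \subset T)]| <= 1)%N.
Proof.
move=> f2 f2' ff'; have U3 : (3 <= #|f :|: f'|)%N.
  rewrite ltnNge; apply/negP => U2; case/eqP: ff'.
  have e1 : f = f :|: f'.
    by apply/eqP; rewrite eqEcard finset.subsetUl f2 U2.
  have e2 : f' = f :|: f'.
    by apply/eqP; rewrite eqEcard finset.subsetUr f2' U2.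
  by rewrite e1 -e2.
apply/card_le1_eqP => T T'; rewrite !inE -!andbA.
move=> /and4P[/eqP T3 _ fT fT'] /and4P[/eqP T3' _ fT1 fT1'].
have e1 : f :|: f' = T by apply/eqP; rewrite eqEcard finset.subUset fT fT' T3 U3.
have e2 : f :|: f' = T' by apply/eqP; rewrite eqEcard finset.subUset fT1 fT1' T3' U3.
by rewrite -e1 e2.
Qed.

Lemma sum_edge_triangles G F :
  (\sum_(f in F) #|[set T in triangles G | f \subset T]| =
   \sum_(T in triangles G) #|[set f in F | f \subset T]|)%N.
Proof.
under eq_bigr do rewrite -sum1_card.
under [RHS]eq_bigr do rewrite -sum1_card.
rewrite (exchange_big_dep (fun T => T \in triangles G)) /=; last first.
  by move=> f T _; rewrite inE => /andP[].
by apply: eq_bigr => T TG; apply: eq_bigl => f; move: TG; rewrite !inE => ->.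
Qed.

Lemma hit_count_le G F :
  (hit_count G F <= \sum_(f in F) #|[set T in triangles G | f \subset T]|)%N.
Proof.
rewrite sum_edge_triangles /hit_count -sum1_card big_mkcond [leqRHS]big_mkcond /=.
apply: leq_sum => T _; rewrite inE; case: (T \in triangles G) => //=.
have [/existsP[f /andP[fF fT]]|] //= := boolP (hits F T); apply/card_gt0P; exists f.
by rewrite inE fF.
Qed.

(** A triangle containing [c > 0] edges of [F] is counted [c - 1] times too often, at most the
    number of ordered pairs of distinct edges of [F] inside it. Each such pair lies in at most one
    triangle, so the total excess is at most [#|F| ^ 2]. *)
Lemma hit_count_ge G F : F \subset complete_graph n ->
  (\sum_(f in F) #|[set T in triangles G | f \subset T]| <= hit_count G F + #|F| ^ 2)%N.
Proof.
move=> FK; have F2 f : f \in F -> #|f| = 2%N.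
  by move=> /(fintype.subsetP FK); rewrite inE => /eqP.
pose P T := [set q in finset.setX F F | [&& q.1 != q.2, q.1 \subset T & q.2 \subset T]].
have sP : (\sum_(T in triangles G) #|P T| <= #|F| ^ 2)%N.
  under eq_bigr do rewrite -sum1_card.
  rewrite (exchange_big_dep (fun q => q \in finset.setX F F)) /=; last first.
    by move=> T q _; rewrite inE => /andP[].
  rewrite -mulnn -cardsX -sum1_card; apply: leq_sum => q qF.
  have [qq|qq] := eqVneq q.1 q.2.
    by rewrite big1 // => T; rewrite !inE qq eqxx /= !andbF.
  move: (qF); rewrite inE => /andP[q1 q2].
  rewrite sum1_card; apply: leq_trans (card_triangles_two_edges G (F2 _ q1) (F2 _ q2) qq).
  apply: subset_leq_card; apply/fintype.subsetP => T.
  move=> /andP[TG]; rewrite inE => /andP[_ /and3P[_ h1 h2]].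
  by rewrite inE TG h1 h2.
rewrite sum_edge_triangles; apply: leq_trans (leq_add (leqnn _) sP).
rewrite /hit_count -sum1_card [X in (_ <= X + _)%N](_ : _ = \sum_(T in triangles G) (hits F T : nat))%N.
  rewrite -big_split /=; apply: leq_sum => T TG.
  have [/existsP[f /andP[fF fT]]|nh] := boolP (hits F T); last first.
    rewrite (_ : [set f in F | f \subset T] = finset.set0) ?cards0 //.
    apply/setP => f; rewrite !inE; apply/negbTE; apply: contra nh => ?.
    by apply/existsP; exists f.
  rewrite (cardsD1 f) inE fF fT leq_add2l.
  rewrite -(@card_imset _ _ (pair f)) => [|a b [] //].
  apply: subset_leq_card; apply/fintype.subsetP => q /imsetP[g].
  rewrite !inE => /and3P[gf gF gT] ->.
  by rewrite /= fF gF fT gT eq_sym gf.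
rewrite big_mkcond [RHS]big_mkcond; apply: eq_bigr => T _; rewrite inE.
by case: (T \in _) => //=; case: hits.
Qed.

End TriangleCounts.

(** * The probability of being hit in one step, and its error *)

Section Numerics.
Variables (R : realType) (n : nat).
Hypothesis n0 : (0 < n)%N.
Let p i := pp R n i.
Let z i := zeta R n i.

(** The ideal co-degree [n p^2] over the ideal number of triangles [n^3 p^3 / 6]: the approximate
    chance that a given edge disappears in one step. *)
Definition rate i : R := 6 / (n%:R ^+ 2 * pp R n i).
Let x i := rate i.

Let nR : 0 < n%:R :> R. Proof. by rewrite ltr0n. Qed.

Lemma pp0 : p 0 = 1.
Proof. by rewrite /p /pp /time mul0r mulr0 subr0. Qed.

Lemma pp_le1 i : p i <= 1.
Proof.
by rewrite /p /pp /time gerBl mulr_ge0 // divr_ge0 ?ler0n ?exprn_ge0 ?ler0n.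
Qed.

Lemma pp_anti i j : (i <= j)%N -> p j <= p i.
Proof.
move=> ij; rewrite /p /pp /time lerB // ler_wpM2l // ler_wpM2r ?ler_nat //.
Qed.

Lemma ppS i : 0 < p i -> p i.+1 = p i * (1 - x i).
Proof.
move=> pi0; rewrite /x /rate mulrBr mulr1 -/(p i).
rewrite (_ : p i.+1 = p i - 6 / n%:R ^+ 2); last first.
  by rewrite /p /pp /time -natr1; field; rewrite pnatr_eq0 -lt0n.
congr (_ - _); field; by rewrite (gt_eqF pi0) /= pnatr_eq0 -lt0n.
Qed.

Lemma rate_gt0 i : 0 < p i -> 0 < x i.
Proof. by move=> pi0; rewrite divr_gt0 // mulr_gt0 // exprn_gt0. Qed.

Lemma rate_lt1 i : 0 < p i -> 0 < p i.+1 -> x i < 1.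
Proof. by move=> pi0; rewrite ppS // pmulr_rgt0 // subr_gt0. Qed.

Hypothesis l1 : 1 <= ln n%:R :> R.

Let sn0 : 0 < Num.sqrt n%:R :> R. Proof. by rewrite sqrtr_gt0. Qed.

Lemma zeta_gt0 i : 0 < p i -> 0 < z i.
Proof.
by move=> pi0; rewrite divr_gt0 ?mulr_gt0 // (lt_le_trans ltr01).
Qed.

Lemma zeta_mono i j : (i <= j)%N -> 0 < p j -> z i <= z j.
Proof.
move=> ij pj; have pi0 : 0 < p i by apply: lt_le_trans pj (pp_anti ij).
rewrite /z /zeta ler_wpM2l ?(le_trans ler01) // lef_pV2 ?posrE ?mulr_gt0 //.
by rewrite ler_wpM2l ?(ltW sn0) // pp_anti.
Qed.

Lemma zetaS i : 0 < p i -> 0 < p i.+1 -> z i.+1 = z i / (1 - x i).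
Proof.
move=> pi0 pi1; have := rate_lt1 pi0 pi1 => x1.
rewrite /z /zeta -/(p i.+1) -/(p i) ppS //; field.
by rewrite (gt_eqF sn0) (gt_eqF pi0) /= gt_eqF // subr_gt0.
Qed.

(* Since [p (i+1) = p i * (1 - x i)], the errors [x i * zeta i] telescope. *)
Lemma rate_zeta i : 0 < p i -> 0 < p i.+1 -> x i * z i <= z i.+1 - z i.
Proof.
move=> pi0 pi1; have x1 := rate_lt1 pi0 pi1; have x0 := rate_gt0 pi0.
have z0 := zeta_gt0 pi0.
rewrite zetaS // lerBrDr -[X in _ + X]mul1r -mulrDl mulrC.
rewrite ler_wpM2l ?(ltW z0) // -[leRHS]mul1r ler_pdivlMr ?subr_gt0 //.
nra.
Qed.

Lemma rate_le_zeta i : (6 <= n)%N -> 0 < p i -> z i <= 1 -> x i <= z i.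
Proof.
move=> n6 pi0 z1; apply: (@le_trans _ _ (z i ^+ 2)); last first.
  by rewrite expr2 ler_piMr // ltW // zeta_gt0.
rewrite /x /rate /z /zeta -/(p i) expr_div_n exprMn sqr_sqrtr ?ler0n //.
rewrite ler_pdivrMr ?mulr_gt0 ?exprn_gt0 // mulrAC ler_pdivlMr ?mulr_gt0 ?exprn_gt0 //.
rewrite (_ : ln n%:R ^+ 2 * (n%:R ^+ 2 * p i) = (ln n%:R ^+ 2 * n%:R) * (n%:R * p i)); last by ring.
rewrite (_ : 6 * (n%:R * p i ^+ 2) = (6 * p i) * (n%:R * p i)); last by ring.
rewrite ler_wpM2r ?mulr_ge0 ?ler0n ?(ltW pi0) //.
have h6 : 6 <= n%:R :> R by rewrite ler_nat.
have := pp_le1 i; have : 1 <= ln n%:R ^+ 2 :> R by rewrite exprn_ege1.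
nra.
Qed.

Section OneStep.
Variables (C : R) (i : nat) (G : graph n).
Hypotheses (C0 : 0 <= C) (pi0 : 0 < p i) (Cz : C * z i <= 2^-1) (z1 : z i <= 1).

Definition regular : Prop :=
  (forall u v : 'I_n, u != v ->
     `| (codeg G u v)%:R / (n%:R * p i ^+ 2) - 1 | <= C * z i) /\
  `| (numtri G)%:R / (6^-1 * n%:R ^+ 3 * p i ^+ 3) - 1 | <= C * z i ^+ 2.

Hypotheses (reg : regular) (GK : G \subset complete_graph n).

Let c0 : R := n%:R * p i ^+ 2.
Let q0 : R := 6^-1 * n%:R ^+ 3 * p i ^+ 3.
Let c0_gt0 : 0 < c0. Proof. by rewrite mulr_gt0 ?exprn_gt0. Qed.
Let q0_gt0 : 0 < q0. Proof. by rewrite !mulr_gt0 ?exprn_gt0. Qed.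

Let dist_rel (a b c : R) : 0 < b -> `|a / b - 1| <= c -> `|a - b| <= c * b.
Proof.
move=> b0; rewrite -[in X in _ -> X](@gtr0_norm _ b b0) => h.
rewrite (_ : a - `|b| = (a / b - 1) * b); last first.
  by rewrite gtr0_norm //; field; rewrite gt_eqF.
by rewrite normrM ler_wpM2r.
Qed.

Let Qdist : `|(numtri G)%:R - q0| <= C * z i * q0.
Proof.
have [_ /(dist_rel q0_gt0) h] := reg; apply: le_trans h _.
rewrite ler_wpM2r ?(ltW q0_gt0) // ler_wpM2l // expr2 ler_piMr //.
exact/ltW/zeta_gt0.
Qed.

Let Qhalf : 2^-1 * q0 <= (numtri G)%:R.
Proof.
move: Qdist; rewrite ler_norml => /andP[h _].
have := ler_wpM2r (ltW q0_gt0) Cz; move: h; lra.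
Qed.

Lemma numtri_gt0 : (0 < numtri G)%N.
Proof.
by rewrite -(ltr0n R); apply: lt_le_trans Qhalf; rewrite mulr_gt0.
Qed.

(** Up to an overcount of at most [m ^+ 2], the triangles hitting [F] number the sum of [m]
    co-degrees, each within [C * zeta] of [c0]; dividing by the number of triangles adds an error of
    the same kind. The lower bound of half the ideal number of triangles doubles the constants. *)
Lemma hit_rate (F : graph n) : F \subset G ->
  `|(hit_count G F)%:R / (numtri G)%:R - #|F|%:R * x i| <=
  x i * z i * (4 * C * #|F|%:R + 2 * #|F|%:R ^+ 2).
Proof.
move=> FG; have FK := fintype.subset_trans FG GK.
have z0 := zeta_gt0 pi0.
have Qp : 0 < (numtri G)%:R :> R by rewrite ltr0n numtri_gt0.
set m : R := #|F|%:R.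
pose s : R := (\sum_(f in F) #|[set T in triangles G | f \subset T]|)%N%:R.
have sm : `|s - m * c0| <= m * (C * z i * c0).
  rewrite /s natr_sum /m.
  rewrite (_ : _ - _ = \sum_(f in F) ((#|[set T in triangles G | f \subset T]|)%:R - c0)); last first.
    by rewrite sumrB sumr_const mulr_natl.
  apply: le_trans (ler_norm_sum _ _ _) _.
  rewrite mulr_natl -sumr_const; apply: ler_sum => f fF.
  have := fintype.subsetP FK _ fF; rewrite inE => /cards2P[u [v [uv fE]]].
  rewrite fE card_triangles_edge // -?fE; last exact: (fintype.subsetP FG).
  by apply: dist_rel => //; have [+ _] := reg; apply.
have h1 : (hit_count G F)%:R <= s by rewrite ler_nat hit_count_le.
have h2 : s <= (hit_count G F)%:R + m ^+ 2.
  by rewrite -natrX -natrD ler_nat hit_count_ge.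
have xq : x i * q0 = c0.
  by rewrite /x /rate /q0 /c0 -/(p i); field; rewrite (gt_eqF pi0) pnatr_eq0 -lt0n n0.
(* This lets the absolute overcount [m ^+ 2] be charged as a relative error of order [zeta]. *)
have cz : 1 <= c0 * z i.
  have -> : c0 * z i = ln n%:R ^+ 2 / z i.
    rewrite /c0 /z /zeta -/(p i) -{1}(@sqr_sqrtr _ n%:R) ?ler0n //; field.
    by rewrite (gt_eqF pi0) (gt_eqF sn0) /= gt_eqF // (lt_le_trans ltr01).
  by rewrite ler_pdivlMr // mul1r (le_trans z1) // exprn_ege1.
rewrite -(ler_pM2r Qp) -[X in _ * X <= _](gtr0_norm Qp) -normrM mulrBl divfK ?gt_eqF //.
have x0 := rate_gt0 pi0.
have m0 : 0 <= m by rewrite ler0n.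
have e1 : `|(hit_count G F)%:R - m * c0| <= m * (C * z i * c0) + m ^+ 2.
  by move: sm; rewrite !ler_norml => /andP[a b]; apply/andP; split; nra.
have e2 : `|m * c0 - m * x i * (numtri G)%:R| <= m * (C * z i * c0).
  rewrite -xq (_ : _ - _ = m * x i * (q0 - (numtri G)%:R)); last by ring.
  rewrite normrM (ger0_norm (mulr_ge0 m0 (ltW x0))) [X in _ * X]distrC.
  rewrite (_ : m * (C * z i * (x i * q0)) = m * x i * (C * z i * q0)); last by ring.
  by rewrite ler_wpM2l // mulr_ge0 // ltW.
have e3 : c0 * z i * (2 * C * m + m ^+ 2) <=
    x i * z i * (4 * C * m + 2 * m ^+ 2) * (numtri G)%:R.
  rewrite -xq (_ : x i * q0 * z i * (2 * C * m + m ^+ 2) =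
     x i * z i * (4 * C * m + 2 * m ^+ 2) * (2^-1 * q0)); last by field.
  apply: ler_wpM2l Qhalf; apply: mulr_ge0; first by rewrite mulr_ge0 ?ltW.
  by rewrite addr_ge0 ?mulr_ge0 ?exprn_ge0.
apply: le_trans e3; apply: le_trans (ler_distD (m * c0) _ _) _.
apply: le_trans (lerD e1 e2) _.
have : m ^+ 2 * 1 <= m ^+ 2 * (c0 * z i) by rewrite ler_wpM2l // exprn_ge0.
lra.
Qed.

End OneStep.
End Numerics.

Lemma mean_survival (R : realType) n (G F : graph n) :
  F \subset complete_graph n -> (0 < numtri G)%N ->
  (#|triangles G|%:R)^-1 *
    \sum_(T in triangles G) (F \subset remove_triangle G T)%:R =
  (F \subset G)%:R * (1 - (hit_count G F)%:R / (numtri G)%:R) :> R.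
Proof.
move=> FK Q0; have QR : (numtri G)%:R != 0 :> R by rewrite pnatr_eq0 -lt0n.
under eq_bigr do rewrite sub_remove_triangle // -mulnb natrM.
rewrite -big_distrr /= mulrCA; congr (_ * _).
rewrite (_ : \sum_(T in _) _ = (numtri G)%:R - (hit_count G F)%:R).
  by rewrite -/(numtri G) mulrBr mulVf // mulrC.
apply/eqP; rewrite eq_sym subr_eq; apply/eqP.
rewrite -natr_sum -natrD /numtri /hit_count -!sum1_card; congr _%:R.
rewrite [X in (_ + X)%N](_ : _ = \sum_(T in triangles G) (hits F T : nat))%N.
  by rewrite -big_split /=; apply: eq_bigr => T _; case: hits.
rewrite big_mkcond [RHS]big_mkcond; apply: eq_bigr => T _; rewrite inE.
by case: (T \in _) => //=; case: hits.
Qed.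

(** * Moments of extension counts *)

Section Embeddings.
Variables (n v : nat).
Implicit Types (EH : {set {set 'I_v}}) (J W : {set 'I_v}) (phi : 'I_v -> 'I_n).
Implicit Types (psi : {ffun 'I_v -> 'I_n}) (F G : graph n).

Definition embeddings J phi : {set {ffun 'I_v -> 'I_n}} :=
  [set psi : {ffun 'I_v -> 'I_n} | injectiveb psi && [forall a in J, psi a == phi a]].

Definition edge_image EH psi : graph n := [set psi @: e | e : {set 'I_v} in EH].

Lemma PsiE EH J phi G :
  Psi EH J phi G = #|[set psi in embeddings J phi | edge_image EH psi \subset G]|.
Proof.
apply: eq_card => psi; rewrite !inE -andbA; congr [&& _, _ & _].
apply/forallP/fintype.subsetP => [h f /imsetP[e eE ->]|h e].
  by have := h e; rewrite eE.
by apply/implyP => eE; apply: h; apply/imsetP; exists e.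
Qed.

Lemma edge_image_complete EH J phi psi : psi \in embeddings J phi ->
  (forall e, e \in EH -> #|e| = 2%N) -> edge_image EH psi \subset complete_graph n.
Proof.
rewrite inE => /andP[/injectiveP inj _] E2; apply/fintype.subsetP => f /imsetP[e eE ->].
by rewrite inE card_imset // E2.
Qed.

Lemma card_edge_image EH J phi psi : psi \in embeddings J phi ->
  #|edge_image EH psi| = #|EH|.
Proof.
rewrite inE => /andP[/injectiveP inj _]; rewrite /edge_image card_imset //.
exact: imset_inj.
Qed.

Definition inner EH W : nat := #|[set e in EH | e \subset W]|.

Lemma inner_le EH W : (inner EH W <= #|EH|)%N.
Proof. by apply: subset_leq_card; apply/fintype.subsetP => e; rewrite inE => /andP[]. Qed.

(** An edge of [H] with an endpoint mapped outside [U] cannot land in [F], all of whose edges lie in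
    [U]. So only edges inside the preimage of [U] may coincide with old ones. *)
Lemma card_edge_image_new EH J phi psi F (U : {set 'I_n}) :
  psi \in embeddings J phi -> (forall f, f \in F -> f \subset U) ->
  (#|F| + (#|EH| - inner EH (psi @^-1: U)) <= #|F :|: edge_image EH psi|)%N.
Proof.
move=> psiJ FU; move: (psiJ); rewrite inE => /andP[/injectiveP inj _].
rewrite -[leqRHS](cardsID F) (finset.setIidPr (finset.subsetUl F _)) leq_add2l.
rewrite finset.setDUl finset.setDv finset.set0U.
rewrite -(cardsID [set e : {set 'I_v} | e \subset psi @^-1: U] EH) /inner.
rewrite [X in (X + _ - _)%N](_ : _ = #|[set e in EH | e \subset psi @^-1: U]|); last first.
  by apply: eq_card => e; rewrite !inE.
rewrite addKn -(@card_imset _ _ (fun e : {set 'I_v} => psi @: e)); last exact: imset_inj.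
apply: subset_leq_card; apply/fintype.subsetP => f /imsetP[e].
rewrite !inE => /andP[eW eE] ->; rewrite imset_f // andbT.
apply: contra eW => /FU; rewrite finset.sub_imset_pre //.
Qed.

Lemma card_embeddings_preim J phi W (U : {set 'I_n}) :
  J \subset W -> 
  (#|[set psi in embeddings J phi | psi @^-1: U == W]| <=
     #|U| ^ (#|W| - #|J|) * n ^ (v - #|W|))%N.
Proof.
move=> JW.
pose Fm a : {set 'I_n} := if a \in J then [set phi a] else if a \in W then U else [set: 'I_n].
apply: (@leq_trans #|[set psi : {ffun 'I_v -> 'I_n} | psi \in family Fm]|).
  apply: subset_leq_card; apply/fintype.subsetP => psi; rewrite !inE.
  move=> /andP[/andP[_ /forallP Jphi] /eqP UW]; apply/familyP => a; rewrite /Fm.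
  case: ifPn => aJ; first by have := Jphi a; rewrite aJ /= => /eqP->; rewrite inE.
  by case: ifPn => aW; rewrite ?inE //; move: aW; rewrite -UW inE.
rewrite cardsE card_family foldrE big_image /=.
rewrite (bigID (fun a => a \in W)) /= (bigID (fun a => a \in J)) /=.
rewrite [X in (X * _ * _)%N]big1 ?mul1n; last first.
  by move=> a /andP[_ aJ]; rewrite /Fm aJ cards1.
rewrite leq_mul //.
  rewrite (eq_bigr (fun=> #|U|)) => [|a /andP[aW aJ]]; last by rewrite /Fm (negbTE aJ) aW.
  rewrite (eq_bigl (fun a => a \in W :\: J)) => [|a]; last by rewrite /= inE andbC.
  by rewrite prod_nat_const cardsD (finset.setIidPr JW).
rewrite (eq_bigr (fun=> n)) => [|a aW]; last first.
  rewrite /Fm (negbTE aW) (_ : a \in J = false) ?cardsT ?card_ord //.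
  by apply/negbTE; apply: contra aW => /(fintype.subsetP JW).
rewrite (eq_bigl (fun a => a \in ~: W)) => [|a]; last by rewrite /= inE.
by rewrite prod_nat_const cardsCs finset.setCK card_ord.
Qed.

End Embeddings.

Section Moments.
Variables (R : realType) (n v : nat).
Variables (EH : {set {set 'I_v}}) (J : {set 'I_v}) (phi : 'I_v -> 'I_n).
Hypothesis E2 : forall e, e \in EH -> #|e| = 2%N.

(* Sum of [h] over the unions of [F] with the edge sets of [r] embeddings: for
   [h F = (F \subset G)] this is the [r]-th power of the extension count. *)
Fixpoint tuple_sum (h : graph n -> R) (r : nat) (F : graph n) : R :=
  if r is r'.+1 then
    \sum_(psi in embeddings J phi) tuple_sum h r' (F :|: edge_image EH psi)
  else h F.

Lemma tuple_sumZ a h r F :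
  tuple_sum (fun F => a * h F) r F = a * tuple_sum h r F.
Proof.
elim: r F => [|r IH] F //=; rewrite big_distrr; apply: eq_bigr => psi _; exact: IH.
Qed.

Lemma tuple_sum_sum (T : finType) (A : {pred T}) (h : T -> graph n -> R) r F :
  tuple_sum (fun F => \sum_(t in A) h t F) r F = \sum_(t in A) tuple_sum (h t) r F.
Proof.
elim: r F => [|r IH] F //=; rewrite exchange_big /=.
by apply: eq_bigr => psi _; exact: IH.
Qed.

Lemma tuple_sum_le b h1 h2 r (F : graph n) : F \subset complete_graph n ->
  (#|F| + r * #|EH| <= b)%N ->
  (forall F' : graph n, F' \subset complete_graph n -> (#|F'| <= b)%N -> h1 F' <= h2 F') ->
  tuple_sum h1 r F <= tuple_sum h2 r F.
Proof.
elim: r F => [|r IH] F FK Fb h12 /=; first by apply: h12; rewrite // -[#|F|]addn0.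
apply: ler_sum => psi psiJ; apply: IH => //.
  by rewrite finset.subUset FK (edge_image_complete psiJ).
apply: leq_trans Fb; rewrite mulSn addnA leq_add2r.
by rewrite -(card_edge_image EH psiJ) cardsU leq_subr.
Qed.

Lemma tuple_sum_ge0 h r F : (forall F, 0 <= h F) -> 0 <= tuple_sum h r F.
Proof.
by move=> h0; elim: r F => [|r IH] F //=; apply: sumr_ge0.
Qed.

Lemma tuple_sum_ind (G : graph n) r (F : graph n) :
  tuple_sum (fun F => (F \subset G)%:R) r F = (F \subset G)%:R * (Psi EH J phi G)%:R ^+ r.
Proof.
elim: r F => [|r IH] F /=; first by rewrite mulr1.
under eq_bigr do rewrite IH finset.subUset -mulnb natrM.
rewrite PsiE -sum1_card natr_sum exprS mulr_suml mulr_sumr.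
rewrite big_mkcond [RHS]big_mkcond /=; apply: eq_bigr => psi _.
rewrite [in RHS]inE; case: (psi \in _) => //=.
by case: (edge_image EH psi \subset G); rewrite ?mulr1 ?mulr0 ?mul0r ?mul1r.
Qed.

(** Bounds the expected number of further embeddings once at most [u] vertices are occupied: [W] is
    the set of vertices sent to occupied ones, and only the edges not inside [W] are sure to cost a
    factor [p]. *)
Definition ext_bound (u : nat) (p : R) : R :=
  \sum_(W : {set 'I_v} | J \subset W)
     u%:R ^+ (#|W| - #|J|) * n%:R ^+ (v - #|W|) * p ^+ (#|EH| - inner EH W).

Lemma ext_bound_gt0 u p : (0 < u)%N -> 0 < p -> 0 < ext_bound u p.
Proof.
move=> u0 p0; rewrite /ext_bound (bigD1 [set: 'I_v]) ?finset.subsetT //=.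
rewrite ltr_wpDr //.
  apply: sumr_ge0 => W _; rewrite !mulr_ge0 ?exprn_ge0 ?ler0n //; exact: ltW.
by rewrite cardsT card_ord subnn expr0 mulr1 mulr_gt0 ?exprn_gt0 ?ltr0n.
Qed.

Lemma sum_embeddings_le u (p : R) (U : {set 'I_n}) (F : graph n) :
  0 < p <= 1 -> (#|U| <= u)%N -> (forall f, f \in F -> f \subset U) ->
  (forall a, a \in J -> phi a \in U) ->
  \sum_(psi in embeddings J phi) p ^+ #|F :|: edge_image EH psi| <=
  p ^+ #|F| * ext_bound u p.
Proof.
move=> /andP[p0 p1] Uu FU JU; rewrite /ext_bound big_distrr /=.
rewrite (partition_big (fun psi : {ffun 'I_v -> 'I_n} => psi @^-1: U)
   (fun W : {set 'I_v} => J \subset W)) /=; last first.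
  move=> psi; rewrite inE => /andP[_ /forallP hJ]; apply/fintype.subsetP => a aJ.
  by have := hJ a; rewrite aJ inE /= => /eqP->; exact: JU.
apply: ler_sum => W JW.
apply: (@le_trans _ _ (\sum_(psi in [set psi in embeddings J phi | psi @^-1: U == W])
    p ^+ (#|F| + (#|EH| - inner EH W)))).
  rewrite big_mkcond [leRHS]big_mkcond /=; apply: ler_sum => psi _.
  rewrite [psi \in [set _ in _ | _]]inE; case: ifP => // /andP[psiJ /eqP UW].
  rewrite ler_wiXn2l ?(ltW p0) // -UW.
  exact: card_edge_image_new psiJ FU.
rewrite sumr_const -[leLHS]mulr_natl exprD [leLHS]mulrCA.
apply: ler_wpM2l; first by rewrite exprn_ge0 // ltW.
apply: ler_wpM2r; first by rewrite exprn_ge0 // ltW.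
rewrite -!natrX -natrM ler_nat; apply: leq_trans (card_embeddings_preim phi U JW) _.
have Uuk k : (#|U| ^ k <= u ^ k)%N by case: k => // k; rewrite leq_exp2r.
by rewrite leq_mul2r Uuk orbT.
Qed.

(** Embeddings are added one at a time; each enlarges the occupied set [U] by at most [v] vertices,
    whence the budget [r * v]. *)
Lemma tuple_sum_expn_le u (p : R) r (U : {set 'I_n}) (F : graph n) :
  0 < p <= 1 -> (#|U| + r * v <= u)%N -> (forall f, f \in F -> f \subset U) ->
  (forall a, a \in J -> phi a \in U) ->
  tuple_sum (fun F => p ^+ #|F|) r F <= p ^+ #|F| * ext_bound u p ^+ r.
Proof.
move=> p01; have [p0 _] := andP p01.
have b0 : 0 <= ext_bound u p.
  by apply: sumr_ge0 => W _; rewrite !mulr_ge0 ?exprn_ge0 ?ler0n // ltW.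
elim: r U F => [|r IH] U F Uu FU JU /=; first by rewrite mulr1.
apply: (@le_trans _ _ (\sum_(psi in embeddings J phi)
    p ^+ #|F :|: edge_image EH psi| * ext_bound u p ^+ r)).
  apply: ler_sum => psi _; apply: (IH (U :|: psi @: [set: 'I_v])).
  - apply: leq_trans Uu; rewrite mulSn addnA leq_add2r.
    apply: leq_trans (_ : _ <= #|U| + #|psi @: [set: 'I_v]|)%N _.
      by rewrite cardsU leq_subr.
    by rewrite leq_add2l (leq_trans (leq_imset_card _ _)) // cardsT card_ord.
  - move=> f; rewrite inE => /orP[/FU fU|/imsetP[e eE ->]].
      by apply: fintype.subset_trans fU (finset.subsetUl _ _).
    apply: fintype.subset_trans (finset.subsetUr _ _).
    by apply: imsetS; exact: finset.subsetT.
  - by move=> a /JU aU; rewrite inE aU.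
rewrite -mulr_suml exprS mulrA ler_wpM2r ?exprn_ge0 //.
apply: sum_embeddings_le FU JU => //.
by apply: leq_trans Uu; rewrite leq_addr.
Qed.

End Moments.

Lemma bernoulli (R : realType) (x : R) m : 0 <= x <= 1 -> 1 - m%:R * x <= (1 - x) ^+ m.
Proof.
move=> /andP[x0 x1]; elim: m => [|m IH]; first by rewrite mul0r subr0.
rewrite exprS; apply: (@le_trans _ _ ((1 - x) * (1 - m%:R * x))).
  have : 0 <= m%:R * x * x by rewrite !mulr_ge0.
  rewrite -natr1; lra.
by rewrite ler_wpM2l // subr_ge0.
Qed.

(** * Upper tails from moments of logarithmic order *)

Section PsiUpper.
Variables (R : realType) (n v : nat) (EH : {set {set 'I_v}}) (J : {set 'I_v}).
Variables (phi : 'I_v -> 'I_n) (C : R) (i r u : nat).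
Hypotheses (n6 : (6 <= n)%N) (l1 : 1 <= ln n%:R :> R) (C0 : 0 <= C).
Hypotheses (in2 : (i <= n ^ 2)%N) (pi0 : 0 < pp R n i).
Hypotheses (Cz : C * zeta R n i <= 2^-1) (z1 : zeta R n i <= 1).
Let b := (r * #|EH|)%N.
Let K : R := 4 * C * b%:R + 2 * b%:R ^+ 2.
Hypotheses (bz : b%:R * zeta R n i <= 2^-1) (Kz : 2 * K * zeta R n i <= 1).
Hypotheses (u0 : (0 < u)%N) (Ju : (#|J| + r * v <= u)%N).
Hypothesis E2 : forall e, e \in EH -> #|e| = 2%N.

Let p := pp R n.
Let z := zeta R n.
Let x := rate R n.

Let n0 : (0 < n)%N. Proof. exact: leq_trans n6. Qed.

(** Seen from time [j], the heuristic probability that [F] survives until time [i]. *)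
Let weight j (G F : graph n) : R := (F \subset G)%:R * (p i / p j) ^+ #|F|.

(** The exponential prefactor absorbs the one-step errors [2 * K * x * zeta], which telescope; by
    [Kz] it never falls below [expR (- 1)]. *)
Let f j G : R :=
  expR (- (2 * K * z j)) * tuple_sum EH J phi (weight j G) r finset.set0.

Let pj j : (j <= i)%N -> 0 < p j.
Proof. by move=> ji; exact: lt_le_trans pi0 (pp_anti R n ji). Qed.

Let zj j : (j <= i)%N -> 0 < z j <= z i.
Proof. by move=> ji; rewrite zeta_gt0 ?zeta_mono //; exact: pj. Qed.

Let K0 : 0 <= K.
Proof. by rewrite addr_ge0 ?mulr_ge0 ?ler0n ?exprn_ge0. Qed.

(** With [w = #|F| * x] and error [y], survival has probability at most [1 - w + y]. As [w <= 1/2],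
    this is at most [(1 + 2 * y) * (1 - w)], and Bernoulli's inequality replaces [1 - w] by the
    power of [1 - x] in the change of weight. *)
Let weight_step j (G F : graph n) : (j < i)%N -> G \subset complete_graph n ->
  regular C j G -> F \subset complete_graph n -> (#|F| <= b)%N ->
  (#|triangles G|%:R)^-1 *
    \sum_(T in triangles G) weight j.+1 (remove_triangle G T) F <=
  expR (2 * K * (x j * z j)) * weight j G F.
Proof.
move=> ji GK reg FK Fb.
have p0 := pj (ltnW ji); have p1 := pj ji; have /andP[z0 zji] := zj (ltnW ji).
have Cz' : C * z j <= 2^-1 by apply: le_trans Cz; rewrite ler_wpM2l.
have z1' : z j <= 1 by exact: le_trans z1.
have Q0 := numtri_gt0 n0 l1 C0 p0 Cz' z1' reg.
rewrite /weight -big_distrl /= [leLHS]mulrA (mean_survival R FK Q0).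
have [FG|_] := boolP (F \subset G); last by rewrite !mul0r mulr0.
rewrite !mul1r.
have x0 : 0 < x j by apply: rate_gt0.
have x1 : x j < 1 by apply: rate_lt1.
rewrite (_ : p i / p j.+1 = p i / p j / (1 - x j)); last first.
  by rewrite /p ppS // invfM mulrA.
rewrite [in leLHS]expr_div_n [leLHS]mulrCA [leRHS]mulrC.
apply: ler_wpM2l; first by rewrite exprn_ge0 // divr_ge0 ?ltW.
rewrite ler_pdivrMr ?exprn_gt0 ?subr_gt0 //.
have := hit_rate n0 l1 C0 p0 Cz' z1' reg GK FG.
rewrite ler_norml => /andP[h _].
have Fb' : #|F|%:R <= b%:R :> R by rewrite ler_nat.
have KF : 4 * C * #|F|%:R + 2 * #|F|%:R ^+ 2 <= K.
  rewrite lerD // ler_wpM2l ?mulr_ge0 //.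
  by rewrite lerXn2r ?nnegrE ?ler0n.
have xz : x j * z j * (4 * C * #|F|%:R + 2 * #|F|%:R ^+ 2) <= K * (x j * z j).
  by rewrite mulrC ler_wpM2r // mulr_ge0 // ltW.
have Fx : #|F|%:R * x j <= 2^-1.
  apply: le_trans bz; apply: ler_pM => //; first exact: ltW.
  by apply: le_trans zji; apply: rate_le_zeta.
have xz0 : 0 <= K * (x j * z j) by apply: mulr_ge0 => //; rewrite mulr_ge0 ?ltW.
apply: (@le_trans _ _ ((1 + 2 * K * (x j * z j)) * (1 - #|F|%:R * x j))); last first.
  apply: ler_pM.
  - lra.
  - lra.
  - exact: expR_ge1Dx.
  - by apply: bernoulli; rewrite !ltW.
move: h xz Fx xz0; set h := _ / _; rewrite -/(x j) -/(z j) -(mulrA 2).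
move: (K * (x j * z j)) (#|F|%:R * x j) => y w h1 h2 h3 y0.
have := mulr_ge0 y0 (_ : 0 <= 2^-1 - w); rewrite subr_ge0 => /(_ h3); lra.
Qed.

(** Markov's inequality for the [r]-th power: the moment is essentially at most [B ^+ r], and
    exceeding [expR 1 * B] gains [expR (- r)]. The remaining factor [expR 1] pays for the prefactor
    in [f]. *)
Lemma Psi_upper :
  Prob (R := R) (fun s : seq (graph n) =>
    (forall j, (j < i)%N -> regular C j (nth (complete_graph n) s j)) /\
    expR 1 * ext_bound n EH J u (p i) <= (Psi EH J phi (nth (complete_graph n) s i))%:R)
  <= expR (1 - r%:R).
Proof.
have B0 := ext_bound_gt0 n EH J u0 pi0; rewrite -/p in B0.
set B := ext_bound _ _ _ _ _ in B0 *.
pose a : R := expR (- 1) * (expR 1 * B) ^+ r.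
have a0 : 0 < a by rewrite mulr_gt0 ?expR_gt0 ?exprn_gt0 ?mulr_gt0 ?expR_gt0.
have f0 j G : (j <= i)%N -> 0 <= f j G.
  move=> ji; rewrite mulr_ge0 ?expR_ge0 // tuple_sum_ge0 // => F.
  by rewrite mulr_ge0 ?ler0n // exprn_ge0 // divr_ge0 // ltW // pj.
have fS j (G : graph n) : (j < i)%N -> G \subset complete_graph n -> regular C j G ->
    (0 < numtri G)%N /\
    (#|triangles G|%:R)^-1 * \sum_(T in triangles G) f j.+1 (remove_triangle G T) <= f j G.
  move=> ji GK reg; have p0 := pj (ltnW ji); have p1 := pj ji.
  have /andP[z0 zji] := zj (ltnW ji).
  split.
    apply: numtri_gt0 reg => //; last exact: le_trans z1.
    by apply: le_trans Cz; rewrite ler_wpM2l.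
  rewrite /f -big_distrr /= [leLHS]mulrCA -tuple_sum_sum -[X in _ * X <= _]tuple_sumZ.
  apply: (@le_trans _ _ (expR (- (2 * K * z j.+1)) *
      tuple_sum EH J phi (fun F => expR (2 * K * (x j * z j)) * weight j G F) r finset.set0)).
    apply: ler_wpM2l; first exact: expR_ge0.
    apply: (@tuple_sum_le _ _ _ _ _ _ E2 b) => //; first exact: finset.sub0set.
      by rewrite cards0.
    by move=> F FK Fb; apply: weight_step.
  rewrite tuple_sumZ mulrA -expRD ler_wpM2r ?tuple_sum_ge0 //.
    by move=> F; rewrite mulr_ge0 ?ler0n // exprn_ge0 // divr_ge0 // ltW.
  rewrite ler_expR; have := rate_zeta n0 l1 p0 p1; rewrite -/x -/z => h.
  have : 2 * K * (x j * z j) <= 2 * K * (z j.+1 - z j) by rewrite ler_wpM2l // mulr_ge0.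
  lra.
have V := ville a0 f0 fS in2.
apply: (@le_trans _ _ (f 0%N (complete_graph n) / a)); last first.
  rewrite ler_pdivrMr //; apply: (@le_trans _ _ (B ^+ r)).
    rewrite /f -[leRHS]mul1r; apply: ler_pM.
    - exact: expR_ge0.
    - by apply: tuple_sum_ge0 => F; rewrite mulr_ge0 ?ler0n // exprn_ge0 // divr_ge0 // ltW // pj.
    - have /andP[/ltW z00 _] := zj (leq0n i).
      by rewrite -[leRHS]expR0 ler_expR oppr_le0; apply: mulr_ge0 => //; exact: mulr_ge0.
    apply: (@le_trans _ _ (tuple_sum EH J phi (fun F => p i ^+ #|F|) r finset.set0)).
      apply: (@tuple_sum_le _ _ _ _ _ _ E2 b) => //; first exact: finset.sub0set.
        by rewrite cards0.
      move=> F FK _; rewrite /weight FK mul1r {2}/p pp0 divr1 //.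
    apply: le_trans (@tuple_sum_expn_le _ _ _ _ _ _ u _ _ (phi @: J) _ _ _ _ _) _ => //.
    - by rewrite pi0 pp_le1.
    - by apply: leq_trans Ju; rewrite leq_add2r leq_imset_card.
    - by move=> e; rewrite inE.
    - by move=> e eJ; apply: imset_f.
    - by rewrite cards0 expr0 mul1r.
  rewrite /a exprMn !mulrA -{1}[B ^+ r]mul1r ler_wpM2r ?exprn_ge0 ?(ltW B0) //.
  by rewrite -expRM_natl mulr1 -!expRD -[leLHS]expR0 ler_expR; lra.
apply: le_trans V; apply: traj_prob_mono => s [reg PB]; split=> //.
rewrite /f /a; apply: ler_pM; rewrite ?expR_ge0 ?exprn_ge0 ?mulr_ge0 ?expR_ge0 ?(ltW B0) //.
  by rewrite ler_expR lerN2.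
rewrite (_ : tuple_sum _ _ _ _ _ _ = tuple_sum EH J phi
   (fun F => (F \subset nth (complete_graph n) (complete_graph n :: s) i)%:R) r finset.set0); last first.
  have -> // : weight i (nth (complete_graph n) (complete_graph n :: s) i) =
     (fun F => (F \subset nth (complete_graph n) (complete_graph n :: s) i)%:R).
  by apply/funext => F; rewrite /weight divff ?expr1n ?mulr1 // gt_eqF.
rewrite tuple_sum_ind finset.sub0set mul1r lerXn2r ?nnegrE ?ler0n //.
by rewrite mulr_ge0 ?expR_ge0 // ltW.
Qed.

End PsiUpper.

(** * The exponential supermartingale *)

Section Loss.
Variables (n v : nat) (EH : {set {set 'I_v}}) (J : {set 'I_v}) (phi : 'I_v -> 'I_n).
Hypothesis E2 : forall e, e \in EH -> #|e| = 2%N.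
Implicit Types (G : graph n) (T : {set 'I_n}).

Definition loss G T : nat :=
  #|[set psi in embeddings J phi |
      (edge_image EH psi \subset G) && hits (edge_image EH psi) T]|.

Lemma Psi_remove_triangle G T :
  (Psi EH J phi (remove_triangle G T) + loss G T)%N = Psi EH J phi G.
Proof.
have cE (P : pred {ffun 'I_v -> 'I_n}) :
    #|[set psi in embeddings J phi | P psi]| = (\sum_(psi in embeddings J phi) P psi)%N.
  rewrite -sum1_card big_mkcond [RHS]big_mkcond; apply: eq_bigr => psi _.
  by rewrite inE; case: (psi \in embeddings _ _); case: (P psi).
rewrite !PsiE /loss !cE -big_split /=; apply: eq_bigr => psi psiJ.
rewrite sub_remove_triangle ?(edge_image_complete psiJ) //.
by case: (_ \subset G) => //; case: hits.
Qed.

Lemma sum_loss G :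
  (\sum_(T in triangles G) loss G T =
   \sum_(psi in [set psi in embeddings J phi | edge_image EH psi \subset G])
      hit_count G (edge_image EH psi))%N.
Proof.
under eq_bigr do rewrite /loss -sum1_card.
under [RHS]eq_bigr do rewrite /hit_count -sum1_card.
rewrite (exchange_big_dep (fun psi =>
  psi \in [set psi in embeddings J phi | edge_image EH psi \subset G])) /=; last first.
  by move=> T psi _; rewrite !inE -!andbA => /and4P[-> -> -> _].
apply: eq_bigr => psi; rewrite inE => /andP[psiJ psiG]; apply: eq_bigl => T.
by rewrite [psi \in _]inE [in RHS]inE psiJ psiG.
Qed.

(** A lost embedding sends some edge [e] of [H] into [T]. There are at most [9] ways to place the
    two ends of [e] in the three vertices of [T], and each placement leaves an extension rooted at
    [J :|: e]. *)
Lemma loss_le G T D : #|T| = 3%N ->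
  (forall e phi', e \in EH -> (Psi EH (J :|: e) phi' G <= D)%N) ->
  (loss G T <= #|EH| * (9 * D))%N.
Proof.
move=> T3 PD.
have hit_edge e : e \in EH ->
    (#|[set psi in embeddings J phi | (edge_image EH psi \subset G) &&
        (psi @: e \subset T)]| <= 9 * D)%N.
  move=> eE; have /eqP/cards2P[b [c [bc eE2]]] := E2 eE.
  pose phi' (t : 'I_n * 'I_n) a := if a == b then t.1 else if a == c then t.2 else phi a.
  apply: (@leq_trans (\sum_(t in finset.setX T T) Psi EH (J :|: e) (phi' t) G)); last first.
    apply: (@leq_trans (\sum_(t in finset.setX T T) D)); first by apply: leq_sum => t _; exact: PD.
    by rewrite sum_nat_const cardsX T3.
  apply: (@leq_trans #|\bigcup_(t in finset.setX T T)
     [set psi in embeddings (J :|: e) (phi' t) | edge_image EH psi \subset G]|).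
    apply: subset_leq_card; apply/fintype.subsetP => psi.
    rewrite inE => /and3P[psiJ psiG eT]; move: (psiJ); rewrite inE => /andP[inj /forallP agr].
    apply/bigcupP; exists (psi b, psi c).
      rewrite inE /= !(fintype.subsetP eT) // imset_f // eE2 !inE eqxx ?orbT //.
    rewrite inE psiG andbT inE inj /=; apply/forallP => a; apply/implyP.
    rewrite /phi' /=; case: (eqVneq a b) => [->//|ab]; case: (eqVneq a c) => [->//|ac].
    rewrite eE2 !inE (negbTE ab) (negbTE ac) !orbF => aJ; by have := agr a; rewrite aJ.
  elim/big_rec2: _ => [|t y A tT IH]; first by rewrite cards0.
  by rewrite PsiE (leq_trans (leq_card_setU _ _).1) // leq_add2l.
apply: (@leq_trans #|\bigcup_(e in EH) [set psi in embeddings J phi |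
    (edge_image EH psi \subset G) && (psi @: e \subset T)]|).
  apply: subset_leq_card; apply/fintype.subsetP => psi.
  rewrite inE => /and3P[psiJ psiG /existsP[f /andP[/imsetP[e eE ->] eT]]].
  by apply/bigcupP; exists e => //; rewrite inE psiJ psiG.
rewrite -sum_nat_const.
elim/big_rec2: _ => [|e y A eE IH]; first by rewrite cards0.
by rewrite (leq_trans (leq_card_setU _ _).1) // leq_add // hit_edge.
Qed.

End Loss.

Section Complete.
Variables (n v : nat) (EH : {set {set 'I_v}}) (J : {set 'I_v}) (phi : 'I_v -> 'I_n).

Let agree (A : {set 'I_v}) :=
  [set psi : {ffun 'I_v -> 'I_n} | [forall a in A, psi a == phi a]].

Let card_agree A : #|agree A| = (n ^ (v - #|A|))%N.
Proof.
pose Fm a : {set 'I_n} := if a \in A then [set phi a] else [set: 'I_n].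
transitivity #|[set psi : {ffun 'I_v -> 'I_n} | psi \in family Fm]|.
  apply: eq_card => psi; rewrite !inE; apply/forallP/familyP => h a; have := h a; rewrite /Fm.
    by case: (a \in A) => /=; rewrite !inE.
  by case: (a \in A) => //=; rewrite !inE.
rewrite cardsE card_family foldrE big_image /= (bigID (fun a => a \in A)) /=.
rewrite big1 ?mul1n => [|a aA]; last by rewrite /Fm aA cards1.
rewrite (eq_bigr (fun=> n)) => [|a aA]; last by rewrite /Fm (negbTE aA) cardsT card_ord.
rewrite (eq_bigl (fun a => a \in ~: A)) => [|a]; last by rewrite /= inE.
by rewrite prod_nat_const cardsCs finset.setCK card_ord.
Qed.

Lemma Psi_le_expn G : (Psi EH J phi G <= n ^ (v - #|J|))%N.
Proof.
rewrite -card_agree PsiE; apply: subset_leq_card; apply/fintype.subsetP => psi.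
by rewrite !inE => /andP[/andP[_ ->]].
Qed.

(** Among the maps extending [phi], each of at most [v ^ 2] possible collisions occurs in a
    proportion at most [1 / n]; multiplying through by [n] keeps the estimate in natural numbers. *)
Lemma Psi_complete_ge : (forall e, e \in EH -> #|e| = 2%N) -> {in J &, injective phi} ->
  (n * n ^ (v - #|J|) <= n * Psi EH J phi (complete_graph n) + v ^ 2 * n ^ (v - #|J|))%N.
Proof.
move=> E2 phiI.
have -> : Psi EH J phi (complete_graph n) = #|embeddings J phi|.
  rewrite PsiE; apply: eq_card => psi; rewrite inE.
  have [psiJ|//] := boolP (psi \in _).
  by rewrite (edge_image_complete psiJ).
(* Since [phi] is injective on [J], every collision involves a vertex outside [J], which is listed
   first. *)
pose P := finset.setX [set: 'I_v] [set: 'I_v] :&: [set q | (q.1 \notin J) && (q.1 != q.2)].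
pose bad (q : 'I_v * 'I_v) := [set psi in agree J | psi q.1 == psi q.2].
have badc q : q \in P -> (n * #|bad q| <= n ^ (v - #|J|))%N.
  case: q => a b; rewrite !inE /= => /andP[aJ ab].
  have -> : (v - #|J|)%N = (v - #|a |: J|).+1.
    have := max_card (mem (a |: J)); rewrite card_ord cardsU1 aJ add1n => aJv.
    by rewrite subnSK.
  rewrite expnS leq_mul2l; apply/orP; right.
  (* Forgetting the value at [a] loses nothing, as it equals the value at [b]; so bad maps inject
     into those with one more prescribed vertex. *)
  pose reset (psi : {ffun 'I_v -> 'I_n}) := [ffun c => if c == a then phi a else psi c].
  rewrite -card_agree -[leqLHS](@card_in_imset _ _ reset) => [|psi psi'].
    apply: subset_leq_card; apply/fintype.subsetP => chi /imsetP[psi].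
    rewrite inE => /andP[]; rewrite inE => /forallP agr _ ->.
    rewrite inE; apply/forallP => c; rewrite !inE !ffunE.
    by case: (eqVneq c a) => [->|] /=; rewrite ?eqxx.
  rewrite !inE /= => /andP[_ /eqP h] /andP[_ /eqP h'] /ffunP E.
  have E' c : c != a -> psi c = psi' c by move=> ca; have := E c; rewrite !ffunE (negbTE ca).
  by apply/ffunP => c; case: (eqVneq c a) => [->|/E'//]; rewrite h h' E' // eq_sym.
have sub : agree J \subset embeddings J phi :|: \bigcup_(q in P) bad q.
  apply/fintype.subsetP => psi psiJ; rewrite inE [psi \in embeddings _ _]inE.
  move: (psiJ); rewrite inE => agr; rewrite agr andbT.
  case: (boolP (injectiveb psi)) => //= /injectivePn[a [b ab abE]].
  have [aJ|aJ] := boolP (a \in J); last first.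
    apply/bigcupP; exists (a, b); first by rewrite !inE aJ.
    by rewrite inE psiJ /= abE.
  have [bJ|bJ] := boolP (b \in J); last first.
    apply/bigcupP; exists (b, a); first by rewrite !inE bJ eq_sym.
    by rewrite inE psiJ /= abE.
  have := forallP agr a; have := forallP agr b; rewrite aJ bJ /= => /eqP hb /eqP ha.
  by move: ab; rewrite (phiI a b) ?eqxx // -ha -hb.
rewrite -{1}card_agree; apply: leq_trans (_ : n * (#|embeddings J phi| + \sum_(q in P) #|bad q|) <= _)%N.
  rewrite leq_mul2l (leq_trans (subset_leq_card sub)) ?orbT //.
  rewrite (leq_trans (leq_card_setU _ _).1) // leq_add2l.
  elim/big_rec2: _ => [|e y A eE IH]; first by rewrite cards0.
  by rewrite (leq_trans (leq_card_setU _ _).1) // leq_add2l.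
rewrite mulnDr leq_add2l big_distrr /=.
apply: (@leq_trans (\sum_(q in P) n ^ (v - #|J|))); first exact: leq_sum.
rewrite sum_nat_const leq_mul2r; apply/orP; right.
by rewrite (leq_trans (subset_leq_card (subsetIl _ _))) // cardsX cardsT card_ord mulnn.
Qed.

End Complete.

(** Square [expR (t / 2) <= 1 / (1 - t / 2)]. There is no lower bound on [t], so one estimate serves
    both tails. *)
Lemma expR_le_quadratic (R : realType) (t : R) : t <= 4^-1 -> expR t <= 1 + t + t ^+ 2.
Proof.
move=> t4.
have h : 0 < 1 - t / 2 by lra.
have e1 : expR (t / 2) <= (1 - t / 2)^-1.
  rewrite -[leLHS]invrK -expRN lef_pV2 ?posrE ?expR_gt0 //.
  exact: expR_ge1Dx.
have -> : expR t = expR (t / 2) ^+ 2 by rewrite expr2 -expRD; congr expR; lra.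
apply: (@le_trans _ _ ((1 - t / 2)^-1 ^+ 2)).
  by rewrite lerXn2r ?nnegrE ?expR_ge0 ?invr_ge0 ?(ltW h).
rewrite exprVn -[leLHS]mul1r ler_pdivrMr ?exprn_gt0 //.
rewrite -subr_ge0 (_ : _ - 1 = 4^-1 * (t ^+ 2 * (1 - 3 * t + t ^+ 2))); last by field.
by rewrite mulr_ge0 // mulr_ge0 ?sqr_ge0 // addr_ge0 ?sqr_ge0 //; lra.
Qed.

Lemma expn_1B_le (R : realType) (x : R) m : 0 <= x <= 1 ->
  (1 - x) ^+ m <= 1 - m%:R * x + (m%:R * x) ^+ 2.
Proof.
move=> /andP[x0 x1]; apply: (@le_trans _ _ (expR (- (m%:R * x)))).
  rewrite -mulrN expRM_natl; apply: lerXn2r; rewrite ?nnegrE ?expR_ge0 ?subr_ge0 //.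
  exact: expR_ge1Dx.
have mx : 0 <= m%:R * x by rewrite mulr_ge0.
apply: le_trans (@expR_le_quadratic _ _ _) _; first by lra.
by rewrite sqrrN.
Qed.

(** In this lemma and the next, [w] stands for [#|EH| * x], [y] for the error of one step and [D]
    for the increment of [tilt] that has to absorb it. *)
Lemma drift_plus (R : realType) (D w y : R) : 0 <= y -> 0 <= w -> w <= 8^-1 ->
  2 * y <= D -> 1 - w + y <= (1 + D) * (1 - w).
Proof.
move=> y0 w0 w8 yD; have : 0 <= D * (8^-1 - w) by rewrite mulr_ge0 //; lra.
lra.
Qed.

Lemma drift_minus (R : realType) (D w y : R) : 0 <= y -> y <= 4^-1 -> 0 <= w -> w <= 8^-1 ->
  2 * y + 2 * w ^+ 2 <= D -> (1 + D)^-1 * (1 - w + w ^+ 2) <= 1 - w - y.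
Proof.
move=> y0 y4 w0 w8 yD; have w2 : 0 <= w ^+ 2 by exact: sqr_ge0.
rewrite mulrC ler_pdivrMr; last by lra.
have : 0 <= D * (2^-1 - w - y) by rewrite mulr_ge0 //; lra.
lra.
Qed.

Section ExponentialSupermartingale.
Variables (R : realType) (n v : nat) (EH : {set {set 'I_v}}) (IH : {set 'I_v}).
Variables (phi : 'I_v -> 'I_n) (C : R) (i : nat) (lam beta : R).
Hypotheses (n6 : (6 <= n)%N) (l1 : 1 <= ln n%:R :> R) (C0 : 0 <= C).
Hypotheses (in2 : (i <= n ^ 2)%N) (pi0 : 0 < pp R n i).
Hypotheses (Cz : C * zeta R n i <= 2^-1) (z1 : zeta R n i <= 1).
Let e : R := #|EH|%:R.
Let K : R := 4 * C * e + 2 * e ^+ 2.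
(** Bounds one jump of the exponent: a jump is at most [beta * S j], the tilting factor is at most
    [2], and so is [S j / S j.+1]. *)
Let theta : R := 4 * lam * beta.
Let kappa : R := 2 * K + 2 * e ^+ 2.

(* The factor by which [lam] has to be tilted at time [j] in order to absorb both
   the drift and the variance of [Psi / S_H]. *)
Definition tilt j : R := kappa * zeta R n j - 2 * theta * (e + K) * ln (pp R n j).

Hypotheses (eKz : (e + K) * zeta R n i <= 8^-1).
Hypotheses (lam0 : 0 < lam) (beta0 : 0 <= beta) (theta4 : theta <= 4^-1).
Hypothesis (gi : tilt i <= 2^-1).
Hypothesis E2 : forall e, e \in EH -> #|e| = 2%N.

Let p := pp R n.
Let z := zeta R n.
Let x := rate R n.
Let S := scaling (R := R) n EH IH.

Let n0 : (0 < n)%N. Proof. exact: leq_trans n6. Qed.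
Let pj j : (j <= i)%N -> 0 < p j.
Proof. by move=> ji; exact: lt_le_trans pi0 (pp_anti R n ji). Qed.
Let zj j : (j <= i)%N -> 0 < z j <= z i.
Proof. by move=> ji; rewrite zeta_gt0 ?zeta_mono //; exact: pj. Qed.
Let e0 : 0 <= e. Proof. exact: ler0n. Qed.
Let K0 : 0 <= K. Proof. by rewrite addr_ge0 ?mulr_ge0 ?exprn_ge0. Qed.
Let theta0 : 0 <= theta. Proof. by rewrite !mulr_ge0 ?(ltW lam0). Qed.
Let kappa0 : 0 <= kappa. Proof. by rewrite addr_ge0 ?mulr_ge0 ?exprn_ge0. Qed.
Let eK0 : 0 <= e + K. Proof. exact: addr_ge0. Qed.
Let a0 : 0 <= 2 * theta * (e + K). Proof. by apply: mulr_ge0 => //; exact: mulr_ge0. Qed.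
Let Sj j : (j <= i)%N -> 0 < S j.
Proof. by move=> ji; rewrite mulr_gt0 ?exprn_gt0 ?ltr0n ?pj. Qed.

Lemma tilt_ge0 j : (j <= i)%N -> 0 <= tilt j.
Proof.
move=> ji; have /andP[zj0 _] := zj ji.
rewrite /tilt subr_ge0; apply: (@le_trans _ _ 0).
  by apply: mulr_ge0_le0 => //; exact: ln_le0 (pp_le1 _ _ _).
by apply: mulr_ge0 => //; exact: ltW.
Qed.

Let tilt_mono j : (j <= i)%N -> tilt j <= tilt i.
Proof.
move=> ji; rewrite /tilt lerB //; first by rewrite ler_wpM2l // zeta_mono.
by rewrite ler_wpM2l // ler_ln ?posrE ?pj // pp_anti.
Qed.

(** Two kinds of error telescope against different potentials: [x * zeta] against [zeta], and the
    bare [x] from the variance against [- ln p]. The latter can grow to order [ln n], so [theta] has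
    to be small enough to compensate. *)
Let tilt_step j : (j < i)%N ->
  2 * (x j * (K * z j + theta * (e + K))) + 2 * e ^+ 2 * (x j * z j) <= tilt j.+1 - tilt j.
Proof.
move=> ji; have p0 := pj (ltnW ji); have p1 := pj ji.
have := rate_zeta n0 l1 p0 p1; rewrite -/x -/z => h.
have h1 : kappa * (x j * z j) <= kappa * (z j.+1 - z j) by rewrite ler_wpM2l.
have h2 : x j <= ln (p j) - ln (p j.+1).
  have x1 : 0 < 1 - x j by rewrite subr_gt0; apply: rate_lt1.
  rewrite {2}/p ppS // lnM ?posrE // opprD addrA subrr sub0r -/(x j).
  rewrite -[leLHS]opprK lerN2; have := le_ln1Dx (_ : -1 < - x j).
  by rewrite ltrN2; apply; rewrite -subr_gt0.
have h3 : 2 * theta * (e + K) * x j <= 2 * theta * (e + K) * (ln (p j) - ln (p j.+1)).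
  by rewrite ler_wpM2l.
rewrite /tilt -/p -/z; move: h1 h3; rewrite /kappa.
lra.
Qed.

Section Sign.
Variable sg : R.
Hypothesis sgE : sg = 1 \/ sg = -1.

Let f j (G : graph n) : R :=
  expR (sg * (lam * (expR (- (sg * tilt j)) * ((Psi EH IH phi G)%:R / S j)))).

(** Compares the coefficients of [Psi] in the exponent after and before a step. Bernoulli's
    inequality bounds the power of [1 - x] from below for the upper tail; the lower tail needs
    [expn_1B_le], whose quadratic term is the source of [2 * e ^+ 2] in [kappa]. *)
Let drift j : (j < i)%N ->
  sg - sg * e * x j + x j * (K * z j + theta * (e + K)) <=
  sg * (expR (sg * (tilt j.+1 - tilt j)) * (1 - x j) ^+ #|EH|).
Proof.
move=> ji; have p0 := pj (ltnW ji); have p1 := pj ji.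
have /andP[z0 zji] := zj (ltnW ji).
have x0 : 0 < x j by apply: rate_gt0.
have x1 : x j < 1 by apply: rate_lt1.
have xz : x j <= z j by apply: rate_le_zeta => //; exact: le_trans z1.
have := tilt_step ji; set D := tilt j.+1 - tilt j.
set y := x j * (K * z j + theta * (e + K)).
have y0 : 0 <= y.
  by apply: mulr_ge0; rewrite ?(ltW x0) // addr_ge0 // mulr_ge0 // ltW.
have ex8 : (e + K) * x j <= 8^-1.
  by apply: le_trans eKz; rewrite ler_wpM2l // (le_trans xz).
have ex0 : 0 <= e * x j by rewrite mulr_ge0 // ltW.
have Kx0 : 0 <= K * x j by rewrite mulr_ge0 // ltW.
have y4 : y <= 4^-1.
  have : K * x j * z j <= K * x j by rewrite ler_piMr // (le_trans zji).
  have : theta * ((e + K) * x j) <= 4^-1 * ((e + K) * x j).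
    by rewrite ler_wpM2r // mulr_ge0 // ltW.
  rewrite /y; lra.
move=> hD.
have exz : (e * x j) ^+ 2 <= e ^+ 2 * (x j * z j).
  by rewrite exprMn ler_wpM2l ?exprn_ge0 // expr2 ler_wpM2l // ltW.
have e8 : e * x j <= 8^-1 by apply: le_trans ex8; rewrite mulrDl lerDl.
have exz0 : 0 <= e ^+ 2 * (x j * z j).
  by apply: mulr_ge0; rewrite ?exprn_ge0 // mulr_ge0 // ltW.
have D0 : 0 <= D.
  by apply: le_trans hD; apply: addr_ge0; rewrite -?(mulrA 2) mulr_ge0.
have x01 : 0 <= x j <= 1 by rewrite !ltW.
have e1x : 0 <= (1 - x j) ^+ #|EH| by rewrite exprn_ge0 // subr_ge0 ltW.
have yD : 2 * y <= D by apply: le_trans hD; rewrite lerDl -(mulrA 2) mulr_ge0.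
have y2D : 2 * y + 2 * (e * x j) ^+ 2 <= D.
  by apply: le_trans hD; rewrite lerD2l -(mulrA 2) ler_wpM2l.
case: sgE => ->.
  have h1 := bernoulli #|EH| x01; rewrite -/e in h1.
  rewrite !mul1r; apply: le_trans (drift_plus y0 ex0 e8 yD) _.
  have w1 : 0 <= 1 - e * x j by rewrite subr_ge0 (le_trans e8) // invf_le1 // ler1n.
  by apply: ler_pM; rewrite ?expR_ge1Dx // addr_ge0.
have h1 := expn_1B_le #|EH| x01; rewrite -/e in h1.
have h2 : expR (- D) <= (1 + D)^-1.
  by rewrite expRN lef_pV2 ?posrE ?expR_gt0 ?expR_ge1Dx // ltr_pwDl.
have h3 : expR (- D) * (1 - x j) ^+ #|EH| <= 1 - e * x j - y.
  apply: le_trans (drift_minus y0 y4 ex0 e8 y2D).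
  by apply: ler_pM; rewrite ?expR_ge0.
rewrite !mulN1r mulNr opprK lerNr; apply: le_trans h3 _.
by rewrite !opprD !opprK.
Qed.

Definition tame j (G : graph n) : Prop := regular C j G /\
  forall T, T \in triangles G -> (loss EH IH phi G T)%:R <= beta * S j.

Let meanN (G : graph n) : R :=
  (#|triangles G|%:R)^-1 * \sum_(T in triangles G) (loss EH IH phi G T)%:R.

Let meanN_dist j (G : graph n) : (j < i)%N -> G \subset complete_graph n -> regular C j G ->
  `|meanN G - (Psi EH IH phi G)%:R * (e * x j)| <=
  (Psi EH IH phi G)%:R * (x j * z j * K).
Proof.
move=> ji GK reg; have p0 := pj (ltnW ji); have /andP[z0 zji] := zj (ltnW ji).
have Cz' : C * z j <= 2^-1 by apply: le_trans Cz; rewrite ler_wpM2l.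
have z1' : z j <= 1 by exact: le_trans z1.
rewrite /meanN -natr_sum sum_loss // natr_sum mulr_sumr PsiE.
rewrite (mulr_natl (e * x j)) (mulr_natl (x j * z j * K)).
rewrite -[(e * x j) *+ _]sumr_const -[(x j * z j * K) *+ _]sumr_const -sumrB; apply: le_trans (ler_norm_sum _ _ _) _.
apply: ler_sum => psi; rewrite inE => /andP[psiJ psiG].
have := hit_rate n0 l1 C0 p0 Cz' z1' reg GK psiG.
by rewrite (card_edge_image EH psiJ) [X in `|X - _|]mulrC.
Qed.

Let tilt_exp_le2 j : (j <= i)%N -> expR (- (sg * tilt j)) <= 2.
Proof.
move=> ji; have t0 := tilt_ge0 ji; have t2 := le_trans (tilt_mono ji) gi.
rewrite expRN -[leRHS]invrK lef_pV2 ?posrE ?expR_gt0 ?invr_gt0 //.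
apply: le_trans (expR_ge1Dx _); case: sgE => ->; lra.
Qed.

Let S_step j : (j < i)%N -> S j.+1 = S j * (1 - x j) ^+ #|EH|.
Proof. by move=> ji; rewrite /S /scaling ppS ?pj ?(ltnW ji) // exprMn mulrA. Qed.

(** Expand the exponential of the jump to second order, average over the triangle, return to an
    exponential by [1 + y <= expR y], and finish with [drift]. *)
Let exp_step j (G : graph n) : (j < i)%N -> G \subset complete_graph n -> tame j G ->
  (0 < numtri G)%N /\
  (#|triangles G|%:R)^-1 * \sum_(T in triangles G) f j.+1 (remove_triangle G T) <= f j G.
Proof.
move=> ji GK [reg lossB].
have p0 := pj (ltnW ji); have p1 := pj ji; have /andP[z0 zji] := zj (ltnW ji).
have Cz' : C * z j <= 2^-1 by apply: le_trans Cz; rewrite ler_wpM2l.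
have z1' : z j <= 1 by exact: le_trans z1.
have Q0 := numtri_gt0 n0 l1 C0 p0 Cz' z1' reg.
split=> //.
have x0 : 0 < x j by apply: rate_gt0.
have x1 : x j < 1 by apply: rate_lt1.
pose mu : R := lam * expR (- (sg * tilt j.+1)) / S j.+1.
have S1 := Sj ji; have S0 := Sj (ltnW ji).
have mu0 : 0 < mu by rewrite divr_gt0 // mulr_gt0 ?expR_gt0.
have fE H : f j.+1 H = expR (sg * (mu * (Psi EH IH phi H)%:R)).
  by rewrite /f /mu; congr (expR (sg * _)); rewrite -!mulrA; congr (_ * (_ * _)); rewrite mulrC.
have sg2 : sg ^+ 2 = 1 by case: sgE => ->; rewrite ?sqrrN expr1n.
have ex : 2^-1 <= (1 - x j) ^+ #|EH|.
  have x01 : 0 <= x j <= 1 by rewrite !ltW.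
  apply: le_trans (bernoulli #|EH| x01); rewrite -/e.
  have : (e + K) * x j <= 8^-1.
    apply: le_trans eKz; rewrite ler_wpM2l // (le_trans _ zji) //.
    exact: rate_le_zeta.
  have : 0 <= K * x j by rewrite mulr_ge0 // ltW.
  lra.
have muN T : T \in triangles G -> mu * (loss EH IH phi G T)%:R <= theta.
  move=> TG; apply: (@le_trans _ _ (mu * (beta * S j))).
    by rewrite ler_wpM2l ?lossB // ltW.
  have E (a b w q c : R) : c != 0 -> q != 0 -> a * w / (c * q) * (b * c) = a * b * (w / q).
    by move=> c0 q0; field; rewrite c0 q0.
  rewrite /mu S_step // E ?gt_eqF ?exprn_gt0 ?subr_gt0 //.
  rewrite /theta (_ : 4 * lam * beta = lam * beta * (2 / 2^-1)); last first.
    by rewrite invrK -natrM [lam * beta * _]mulrC mulrA.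
  rewrite ler_wpM2l ?mulr_ge0 ?(ltW lam0) //.
  apply: ler_pM; rewrite ?expR_ge0 ?invr_ge0 ?exprn_ge0 ?subr_ge0 ?(ltW x1) ?tilt_exp_le2 //.
  by rewrite lef_pV2 ?posrE ?exprn_gt0 ?subr_gt0 ?invr_gt0.
clear ex; pose P : R := (Psi EH IH phi G)%:R.
have P0 : 0 <= P by exact: ler0n.
have fT T : T \in triangles G -> f j.+1 (remove_triangle G T) <=
    expR (sg * (mu * P)) * (1 + mu * (theta - sg) * (loss EH IH phi G T)%:R).
  move=> TG; rewrite fE /P.
  rewrite -(Psi_remove_triangle IH phi E2 G T) natrD.
  set P' := (Psi _ _ _ _)%:R; set N := (loss _ _ _ _ _)%:R.
  have N0 : 0 <= mu * N by rewrite mulr_ge0 ?ler0n // ltW.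
  have Nt : mu * N <= theta by exact: muN.
  rewrite (_ : sg * (mu * P') = sg * (mu * (P' + N)) + - sg * (mu * N)); last by ring.
  rewrite expRD ler_wpM2l ?expR_ge0 //.
  apply: le_trans (@expR_le_quadratic _ _ _) _.
    have Nt4 := le_trans Nt theta4; move: N0 Nt4; move: (mu * N) => w.
    case: sgE => -> w0 w4; last by rewrite opprK mul1r.
    by rewrite mulN1r (@le_trans _ _ 0) ?oppr_le0.
  rewrite exprMn sqrrN sg2 mul1r.
  (* The second moment of the jump is thereby bounded by its mean, so no pair counts of extensions
     are needed. *)
  have : (mu * N) ^+ 2 <= theta * (mu * N) by rewrite expr2 ler_wpM2r.
  lra.
have x0z : 0 <= x j * z j * K by apply: mulr_ge0 => //; rewrite mulr_ge0 ?ltW.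
have meanB : (theta - sg) * meanN G <=
    P * (- sg * e * x j + x j * (K * z j + theta * (e + K))).
  have := meanN_dist ji GK reg; rewrite -/P ler_norml => /andP[h1 h2].
  have h3 : theta * meanN G <= theta * (P * (x j * (e + K))).
    rewrite ler_wpM2l //.
    have : P * (x j * z j * K) <= P * (x j * K).
      by rewrite ler_wpM2l // -mulrA ler_wpM2l ?(ltW x0) // ler_piMl.
    lra.
  case: sgE => ->; lra.
have Q0' : 0 < #|triangles G|%:R :> R by rewrite ltr0n.
apply: (@le_trans _ _ (expR (sg * (mu * P)) * (1 + mu * ((theta - sg) * meanN G)))).
  rewrite ler_pdivrMl //; apply: le_trans (ler_sum _ fT) _.
  rewrite -mulr_sumr big_split /= sumr_const -mulr_sumr /meanN.
  rewrite [leRHS]mulrCA ler_wpM2l ?expR_ge0 //.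
  rewrite (_ : #|triangles G|%:R * _ = #|triangles G|%:R + mu * (theta - sg) *
    (#|triangles G|%:R / #|triangles G|%:R * \sum_(T in triangles G) (loss EH IH phi G T)%:R)).
    by rewrite divff ?gt_eqF // mul1r.
  by ring.
apply: (@le_trans _ _ (expR (sg * (mu * P) + mu * ((theta - sg) * meanN G)))).
  by rewrite expRD ler_wpM2l ?expR_ge0 // expR_ge1Dx.
rewrite /f ler_expR -/P.
apply: (@le_trans _ _ (mu * P * (sg * (expR (sg * (tilt j.+1 - tilt j)) * (1 - x j) ^+ #|EH|)))).
  apply: le_trans (ler_wpM2l _ (drift ji)); last by rewrite mulr_ge0 // ltW.
  have := ler_wpM2l (ltW mu0) meanB; lra.
have E (a w w' c q b g : R) : w != 0 -> w' != 0 -> c != 0 -> q != 0 ->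
    a * w^-1 / (c * q) * b * (g * (w / w' * q)) = g * (a * (w'^-1 * (b / c))).
  by move=> h1 h2 h3 h4; field; rewrite h1 h2 h3 h4.
by rewrite /mu S_step // (mulrBr sg (tilt j.+1)) expRD !expRN E ?gt_eqF ?expR_gt0 ?exprn_gt0 ?subr_gt0.
Qed.

Lemma exponential_tail y :
  Prob (R := R) (fun s : seq (graph n) =>
    (forall j, (j < i)%N -> tame j (nth (complete_graph n) s j)) /\
    sg * y <= sg * ((Psi EH IH phi (nth (complete_graph n) s i))%:R / S i)) <=
  expR (sg * (lam * (expR (- (sg * tilt 0)) *
          ((Psi EH IH phi (complete_graph n))%:R / S 0%N))) -
        sg * (lam * (expR (- (sg * tilt i)) * y))).
Proof.
pose a : R := expR (sg * (lam * (expR (- (sg * tilt i)) * y))).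
have V := @ville _ _ f tame a i (expR_gt0 _) (fun _ _ _ => expR_ge0 _) exp_step in2.
rewrite expRD [X in _ <= _ * X]expRN; apply: le_trans V; apply: traj_prob_mono => s [reg h]; split=> //.
rewrite /a /f ler_expR !(mulrCA sg) ler_wpM2l ?(ltW lam0) // ler_wpM2l ?expR_ge0 //.
by rewrite mulrCA.
Qed.

End Sign.
End ExponentialSupermartingale.

(** * Two-sided concentration of the normalised count *)

Section TwoSided.
Variables (R : realType) (n v : nat) (EH : {set {set 'I_v}}) (IH : {set 'I_v}).
Variables (phi : 'I_v -> 'I_n) (C : R) (i : nat) (lam beta eps : R).
Hypotheses (n6 : (6 <= n)%N) (l1 : 1 <= ln n%:R :> R) (C0 : 0 <= C).
Hypotheses (in2 : (i <= n ^ 2)%N) (pi0 : 0 < pp R n i) (pn : n%:R^-1 <= pp R n i).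
Hypotheses (Cz : C * zeta R n i <= 2^-1) (z1 : zeta R n i <= 1).
Let e : R := #|EH|%:R.
Let K : R := 4 * C * e + 2 * e ^+ 2.
Let m : R := Num.min eps 1.
Hypotheses (eKz : (e + K) * zeta R n i <= 8^-1).
Hypothesis E2 : forall e, e \in EH -> #|e| = 2%N.
Hypothesis phiI : {in IH &, injective phi}.
Hypotheses (lam0 : 0 < lam) (beta0 : 0 <= beta) (eps0 : 0 < eps).
Hypothesis kz : (2 * K + 2 * e ^+ 2) * zeta R n i <= m / 16.
Hypothesis vn : v%:R ^+ 2 / n%:R <= m / 4.
Hypothesis lam_beta : 128 * (lam * beta) * (e + K + 1) * ln n%:R <= m.

Let l : R := ln n%:R.
Let S := scaling (R := R) n EH IH.
Let X G : R := (Psi EH IH phi G)%:R / S i.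

Let n0 : (0 < n)%N. Proof. exact: leq_trans n6. Qed.
Let nR : 0 < n%:R :> R. Proof. by rewrite ltr0n. Qed.
Let l0 : 0 < l. Proof. exact: lt_le_trans l1. Qed.
Let e0 : 0 <= e. Proof. exact: ler0n. Qed.
Let K0 : 0 <= K. Proof. by rewrite addr_ge0 ?mulr_ge0 ?exprn_ge0. Qed.
Let m0 : 0 < m. Proof. by rewrite lt_min eps0 ltr01. Qed.
Let m1 : m <= 1. Proof. by rewrite ge_min lexx orbT. Qed.
Let me : m <= eps. Proof. by rewrite ge_min lexx. Qed.

Let lb0 : 0 <= lam * beta. Proof. by rewrite mulr_ge0 // ltW. Qed.

Let theta4 : 4 * lam * beta <= 4^-1.
Proof.
have h1 : 1 <= (e + K + 1) * l.
  by rewrite -[leLHS]mul1r; apply: ler_pM => //; rewrite lerDr addr_ge0.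
have h2 : lam * beta <= lam * beta * ((e + K + 1) * l) by rewrite ler_peMr.
have h3 : 128 * (lam * beta * ((e + K + 1) * l)) <= 1.
  by apply: le_trans m1; apply: le_trans lam_beta; rewrite -!mulrA.
rewrite -mulrA; move: h2 h3; move: (lam * beta) (lam * beta * _) => a b; lra.
Qed.

(** [kz] bounds the [zeta] part by [m / 16]. For the variance part [pn] gives [- ln p <= ln n], and
    [lam_beta] makes the product at most [m / 16]. *)
Let tilt_le : tilt n EH C lam beta i <= m / 8.
Proof.
rewrite /tilt -/e -/K.
have h1 : - ln (pp R n i) <= l.
  rewrite -[l]opprK lerN2 /l -lnV ?posrE //.
  by rewrite ler_ln ?posrE ?invr_gt0.
have h2 : 8 * (lam * beta) * (e + K) * - ln (pp R n i) <= 8 * (lam * beta) * (e + K) * l.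
  by apply: ler_wpM2l => //; apply: mulr_ge0; [exact: mulr_ge0 | exact: addr_ge0].
have h3 : 0 <= lam * beta * l by rewrite mulr_ge0 // ltW.
move: kz lam_beta h2; rewrite -/l.
move: (zeta R n i) (ln (pp R n i)) h3 => z w h3; move: (lam) (beta) h3 => a b h3.
lra.
Qed.

Let gi : tilt n EH C lam beta i <= 2^-1.
Proof. by apply: le_trans tilt_le _; move: m1; lra. Qed.

Let S0E : S 0%N = n%:R ^+ (v - #|IH|).
Proof. by rewrite /S /scaling pp0 expr1n mulr1. Qed.

Let X0 := (Psi EH IH phi (complete_graph n))%:R / S 0%N.

Let X0_le1 : X0 <= 1.
Proof.
by rewrite /X0 S0E ler_pdivrMr ?exprn_gt0 // mul1r -natrX ler_nat Psi_le_expn.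
Qed.

Let X0_ge : 1 - m / 4 <= X0.
Proof.
apply: (@le_trans _ _ (1 - v%:R ^+ 2 / n%:R)); first by rewrite lerB.
rewrite /X0 S0E ler_pdivlMr ?exprn_gt0 // -(ler_pM2l nR).
have := Psi_complete_ge E2 phiI; rewrite -(ler_nat R) natrD !natrM !natrX.
set P := (Psi _ _ _ _)%:R; move: (n%:R ^+ _) => Y h.
rewrite mulrBl mulrBr mul1r mulrA mulrCA divff ?gt_eqF // mulr1.
by rewrite lerBlDr.
Qed.

Let tame_before s' := forall j, (j < i)%N ->
  tame EH IH phi C beta j (nth (complete_graph n) s' j).

Let X0_ge0 : 0 <= X0.
Proof. by rewrite divr_ge0 ?ler0n // S0E exprn_ge0 ?ler0n. Qed.

Let upper : Prob (R := R) (fun s' : seq (graph n) => tame_before s' /\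
    1 + eps <= X (nth (complete_graph n) s' i)) <= expR (- (lam * eps / 2)).
Proof.
have := exponential_tail IH phi n6 l1 C0 in2 pi0 Cz z1 eKz lam0 beta0 theta4 gi E2
  (or_introl (erefl (1 : R))) (1 + eps).
move=> h; apply: (le_trans (le_trans _ h)).
  by apply: traj_prob_mono => s' [t Xs]; split=> //; rewrite !mul1r.
rewrite !mul1r ler_expR -/(S 0) -/X0.
have t0 := tilt_ge0 EH n6 l1 C0 pi0 lam0 beta0 (leqnn i).
have t00 := tilt_ge0 EH n6 l1 C0 pi0 lam0 beta0 (leq0n i).
have e1 : expR (- tilt n EH C lam beta 0) * X0 <= 1.
  by rewrite mulr_ile1 ?expR_ge0 // -expR0 ler_expR oppr_le0.
have e2 := expR_ge1Dx (- tilt n EH C lam beta i).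
have e3 : 1 + eps / 2 <= expR (- tilt n EH C lam beta i) * (1 + eps).
  apply: (@le_trans _ _ ((1 - m / 8) * (1 + eps))); last first.
    by apply: ler_wpM2r; move: tilt_le eps0 e2; lra.
  have E (a b : R) : 0 < b -> a <= b -> a * b <= b -> 1 + b / 2 <= (1 - a / 8) * (1 + b).
    by move=> b0 ab ab1; lra.
  by apply: E => //; rewrite ler_piMl // ltW.
have := ler_wpM2l (ltW lam0) e1; have := ler_wpM2l (ltW lam0) e3.
move: (lam * (_ * X0)) (lam * (_ * (1 + eps))) => a b; lra.
Qed.

Let lower : Prob (R := R) (fun s' : seq (graph n) => tame_before s' /\
    X (nth (complete_graph n) s' i) <= 1 - eps) <= expR (- (lam * eps / 2)).
Proof.
(* For [eps > 1] the event would make a nonnegative count negative. *)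
have [e1|e1] := ltP 1 eps.
  rewrite /Prob traj_prob0 ?expR_ge0 // => s' [_].
  apply/negP; rewrite -ltNge; apply: (@lt_le_trans _ _ 0); first by rewrite subr_lt0.
  by rewrite divr_ge0 // mulr_ge0 ?exprn_ge0 ?ler0n // ltW.
have mE : m = eps by rewrite /m; apply/min_idPl.
have := exponential_tail IH phi n6 l1 C0 in2 pi0 Cz z1 eKz lam0 beta0 theta4 gi E2
  (or_intror (erefl (-1 : R))) (1 - eps).
move=> h; apply: (le_trans (le_trans _ h)).
  by apply: traj_prob_mono => s' [t Xs]; split=> //; rewrite !mulN1r lerN2.
rewrite !mulN1r !opprK ler_expR -/(S 0) -/X0.
have t00 := tilt_ge0 EH n6 l1 C0 pi0 lam0 beta0 (leq0n i).
have a1 : 1 - m / 4 <= expR (tilt n EH C lam beta 0) * X0.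
  by apply: le_trans X0_ge _; rewrite ler_peMl // -expR0 ler_expR.
have t0 := tilt_ge0 EH n6 l1 C0 pi0 lam0 beta0 (leqnn i).
have a2 : expR (tilt n EH C lam beta i) <= 1 + m / 4.
  apply: le_trans (@expR_le_quadratic _ _ _) _; first by move: tilt_le m1; lra.
  have : tilt n EH C lam beta i ^+ 2 <= tilt n EH C lam beta i.
    by rewrite expr2 ler_piMl // (le_trans gi) // invf_le1 // ler1n.
  move: tilt_le; lra.
have a3 : expR (tilt n EH C lam beta i) * (1 - eps) <= 1 - eps + eps / 4.
  apply: (@le_trans _ _ ((1 + m / 4) * (1 - eps))).
    by rewrite ler_wpM2r // subr_ge0.
  have : 0 <= eps * eps by rewrite mulr_ge0 // ltW.
  rewrite mE; lra.
have := ler_wpM2l (ltW lam0) a1; have := ler_wpM2l (ltW lam0) a3; rewrite mE.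
move: (lam * (_ * X0)) (lam * (_ * (1 - eps))) => a b; lra.
Qed.

Lemma two_sided : Prob (R := R) (fun s' : seq (graph n) =>
    (forall j, (j < i)%N -> tame EH IH phi C beta j (nth (complete_graph n) s' j)) /\
    eps < `|(Psi EH IH phi (nth (complete_graph n) s' i))%:R / S i - 1|) <=
  2 * expR (- (lam * eps / 2)).
Proof.
rewrite mulrDl mul1r; apply: le_trans (lerD upper lower).
apply: le_trans (traj_prob_or _ _ _ _ _); apply: traj_prob_mono => s' [before dev].
move: dev; rewrite lter_normr => /orP[] dev; [left | right]; split=> //.
  by rewrite /X; move: dev; rewrite ltrBrDl => /ltW.
by rewrite /X; move: dev; rewrite opprB ltrBrDl -ltrBrDr => /ltW.
Qed.

End TwoSided.

Section Deviation.
Variables (R : realType) (n v : nat) (EH : {set {set 'I_v}}) (IH : {set 'I_v}).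
Variables (phi : 'I_v -> 'I_n) (C : R) (i u : nat) (A eps s : R).
Hypotheses (n6 : (6 <= n)%N) (l1 : 1 <= ln n%:R :> R) (C0 : 0 <= C).
Hypotheses (in2 : (i <= n ^ 2)%N) (pi0 : 0 < pp R n i) (pn : n%:R^-1 <= pp R n i).
Hypotheses (Cz : C * zeta R n i <= 2^-1) (z1 : zeta R n i <= 1).
Let e : R := #|EH|%:R.
Let K : R := 4 * C * e + 2 * e ^+ 2.
Let m : R := Num.min eps 1.
Let U : R := expR 1 * (2 ^+ v * u%:R ^+ (v - #|IH|)).
Hypotheses (eKz : (e + K) * zeta R n i <= 8^-1).
Hypothesis E2 : forall e, e \in EH -> #|e| = 2%N.
Hypothesis phiI : {in IH &, injective phi}.
Hypotheses (A0 : 0 < A) (eps0 : 0 < eps) (s0 : 0 < s) (u0 : (0 < u)%N).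
Hypothesis kz : (2 * K + 2 * e ^+ 2) * zeta R n i <= m / 16.
Hypothesis vn : v%:R ^+ 2 / n%:R <= m / 4.
Hypothesis big : 2304 * A * e * U * (e + K + 1) * ln n%:R ^+ 2 <= m * eps * s.
Hypothesis sW : forall a (W : {set 'I_v}), a \in EH -> IH :|: a \subset W ->
  s <= n%:R ^+ (#|W| - #|IH|) * pp R n i ^+ inner EH W.

Let l : R := ln n%:R.
(** Chosen so that the tail [expR (- (lam * eps / 2))] is [n] to the power [- A]. *)
Let lam : R := 2 * A * l / eps.
Let beta : R := e * (9 * (U / s)).
Let S := scaling (R := R) n EH IH.

Let n0 : (0 < n)%N. Proof. exact: leq_trans n6. Qed.
Let nR : 0 < n%:R :> R. Proof. by rewrite ltr0n. Qed.
Let l0 : 0 < l. Proof. exact: lt_le_trans l1. Qed.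
Let e0 : 0 <= e. Proof. exact: ler0n. Qed.
Let lam0 : 0 < lam. Proof. by rewrite divr_gt0 // !mulr_gt0. Qed.
Let U0 : 0 <= U. Proof. by rewrite !mulr_ge0 ?expR_ge0 ?exprn_ge0. Qed.
Let beta0 : 0 <= beta.
Proof.
by apply: mulr_ge0 => //; apply: mulr_ge0 => //; rewrite divr_ge0 // ltW.
Qed.

(** The constant in [big] is [2304 = 128 * 2 * 9], with [2] from [lam] and [9] from the placements
    of an edge in a triangle. *)
Let lam_beta : 128 * (lam * beta) * (e + K + 1) * ln n%:R <= m.
Proof.
have E (a b c d g h w : R) : b != 0 -> h != 0 ->
    128 * (2 * a * c / b * (d * (9 * (g / h)))) * w * c =
    2304 * a * d * g * w * c ^+ 2 / (b * h).
  by move=> b0 h0; field; rewrite b0 h0.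
rewrite /lam /beta E ?gt_eqF //.
by rewrite ler_pdivrMr ?mulr_gt0 // [leRHS]mulrA; exact: big.
Qed.

(** The scaling of the part outside [W] is [S j] divided by the scaling of [H[W]], which is at least
    [s] at time [i] and so at any earlier time, [p] being decreasing. The [2 ^ v] choices of [W] are
    accounted for in [U]. *)
Let ext_bound_le j a : (j <= i)%N -> a \in EH ->
  expR 1 * ext_bound n EH (IH :|: a) u (pp R n j) <= U / s * S j.
Proof.
move=> ji aE; have pj : 0 < pp R n j by exact: lt_le_trans pi0 (pp_anti R n ji).
have Sj : 0 < S j by rewrite mulr_gt0 ?exprn_gt0.
rewrite /U -!mulrA ler_wpM2l ?expR_ge0 //.
apply: (@le_trans _ _ (\sum_(W : {set 'I_v}) u%:R ^+ (v - #|IH|) * (s^-1 * S j))); last first.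
  have c2 : #|{set 'I_v}| = (2 ^ v)%N.
    by rewrite -cardsT -powersetT card_powerset cardsT card_ord.
  by rewrite sumr_const c2 -[leLHS]mulr_natl natrX.
rewrite /ext_bound big_mkcond; apply: ler_sum => W _; case: ifP => [JW|_]; last first.
  by rewrite mulr_ge0 ?exprn_ge0 // mulr_ge0 ?invr_ge0 // ltW.
have IW : IH \subset W by apply: fintype.subset_trans JW; exact: finset.subsetUl.
have Wv : (#|W| <= v)%N by have := max_card (mem W); rewrite card_ord.
have pk k : 0 <= pp R n j ^+ k by rewrite exprn_ge0 // ltW.
rewrite -!mulrA; apply: ler_pM.
- by rewrite exprn_ge0.
- by rewrite mulr_ge0 // exprn_ge0.
- rewrite ler_weXn2l ?ler1n //.
  exact: leq_sub Wv (subset_leq_card (finset.subsetUl IH a)).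
rewrite ler_pdivlMl //; apply: (@le_trans _ _
  (n%:R ^+ (#|W| - #|IH|) * pp R n j ^+ inner EH W *
   (n%:R ^+ (v - #|W|) * pp R n j ^+ (#|EH| - inner EH W)))).
  apply: ler_wpM2r; first by rewrite mulr_ge0 // exprn_ge0.
  apply: le_trans (sW aE JW) _; apply: ler_wpM2l; first by rewrite exprn_ge0.
  by rewrite lerXn2r ?nnegrE ?(ltW pi0) ?(ltW pj) // pp_anti.
rewrite mulrACA -!exprD /S /scaling (_ : (_ - _ + _)%N = (v - #|IH|)%N); last first.
  by rewrite addnC addnBA ?subset_leq_card // subnK.
by rewrite subnKC ?inner_le.
Qed.

Lemma deviation : Prob (R := R) (fun s' : seq (graph n) =>
    (forall j, (j < i)%N -> regular C j (nth (complete_graph n) s' j) /\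
       forall J phi', (Psi EH J phi' (nth (complete_graph n) s' j))%:R <=
          expR 1 * ext_bound n EH J u (pp R n j)) /\
    eps < `|(Psi EH IH phi (nth (complete_graph n) s' i))%:R / S i - 1|) <=
  2 * expR (- (A * l)).
Proof.
have AE : A * l = lam * eps / 2.
  by rewrite /lam divfK ?gt_eqF // -(mulrA 2) [2 * _]mulrC mulfK // pnatr_eq0.
rewrite AE; apply: le_trans (two_sided n6 l1 C0 in2 pi0 pn Cz z1 eKz E2 phiI
  lam0 beta0 eps0 kz vn lam_beta).
apply: traj_prob_mono => s' [before dev]; split=> // j ji.
have [reg PB] := before j ji; split=> // T TG.
have pj : 0 < pp R n j by exact: lt_le_trans pi0 (pp_anti R n (ltnW ji)).
set G := nth _ _ _ in PB TG *.
have Sj : 0 < S j by rewrite mulr_gt0 ?exprn_gt0.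
have D0 : 0 <= U / s * S j by rewrite mulr_ge0 ?(ltW Sj) // divr_ge0 // ltW.
have T3 : #|T| = 3%N by move: TG; rewrite inE => /andP[/eqP].
have PD a phi' : a \in EH -> (Psi EH (IH :|: a) phi' G <= Num.truncn (U / s * S j))%N.
  by move=> aE; rewrite truncn_ge_nat // (le_trans (PB _ _)) // ext_bound_le // ltnW.
have := loss_le (J := IH) phi E2 T3 (fun a phi1 aE => PD a phi1 aE); rewrite -(ler_nat R) !natrM => h.
apply: le_trans h _; rewrite /beta -/e -[leRHS]mulrA ler_wpM2l // -[leRHS]mulrA ler_wpM2l //.
by rewrite truncn_le.
Qed.

End Deviation.

(** * Uniformity over times and extensions *)

Section UnionBound.
Variables (R : realType) (n N : nat).
Hypothesis n0 : (0 < n)%N.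

Definition union_const : R := (2 * (N.+1 * 2 ^ (2 ^ N) * 2 ^ N))%N%:R.

Definition some_extension (E : nat -> forall v, {set {set 'I_v}} -> {set 'I_v} ->
    ('I_v -> 'I_n) -> seq (graph n) -> Prop) (s : seq (graph n)) : Prop :=
  exists (i : 'I_(n ^ 2).+1) (v : 'I_N.+1) (EH : {set {set 'I_v}})
     (J : {set 'I_v}) (phi : {ffun 'I_v -> 'I_n}), E i v EH J phi s.

(** There are at most [2 * n ^ 2] times and [n ^ N] root maps; vertex numbers, edge sets and root
    sets contribute only constants. Placements range over finite functions, so that the union is
    finite. *)
Lemma prob_some_extension E (q : R) : 0 <= q ->
  (forall i v (EH : {set {set 'I_v}}) J phi, (i <= n ^ 2)%N -> (v <= N)%N ->
     Prob (E i v EH J phi) <= q) ->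
  Prob (some_extension E) <= union_const * n%:R ^+ (N + 2) * q.
Proof.
move=> q0 Eq.
apply: (@le_trans _ _ ((n ^ 2).+1%:R * (N.+1%:R * ((2 ^ (2 ^ N))%:R * ((2 ^ N)%:R *
   ((n ^ N)%:R * q)))))); last first.
  rewrite !mulrA ler_wpM2r // -!natrM -natrX -natrM ler_nat.
  have h : ((n ^ 2).+1 <= 2 * n ^ 2)%N by rewrite mul2n -addnn -addn1 leq_add2l expn_gt0 n0.
  rewrite expnD (_ : (2 * _ * _ = 2 * n ^ 2 * N.+1 * 2 ^ (2 ^ N) * 2 ^ N * n ^ N)%N); last by ring.
  by rewrite !leq_mul2r h !orbT.
have card_set2 v (T : finType) : #|T| = v -> #|{set T}| = (2 ^ v)%N.
  by move=> <-; rewrite -[LHS]cardsT -powersetT card_powerset cardsT.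
have hstep (T : finType) k (F : T -> seq (graph n) -> Prop) (b : R) : 0 <= b ->
    (#|T| <= k)%N -> (forall x, Prob (F x) <= b) ->
    Prob (fun s => exists x, F x s) <= k%:R * b.
  move=> b0 Tk Fb; apply: le_trans (traj_prob_exists Fb) _.
  by rewrite ler_wpM2r // ler_nat.
have p2 k : (0 < 2 ^ k)%N by rewrite expn_gt0.
apply: (hstep) => [||i]; rewrite ?card_ord ?mulr_ge0 //.
apply: (hstep) => [||v]; rewrite ?card_ord ?mulr_ge0 //.
have vN : (v <= N)%N by rewrite -ltnS.
have le2 : (2 ^ v <= 2 ^ N)%N by rewrite leq_exp2l.
apply: (hstep) => [||EH]; rewrite ?mulr_ge0 //.
  by rewrite (card_set2 (2 ^ v)%N) ?leq_exp2l // (card_set2 v) ?card_ord.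
apply: (hstep) => [||J]; rewrite ?mulr_ge0 //.
  by rewrite (card_set2 v) ?card_ord.
apply: (hstep) => [||phi]; rewrite ?card_ffun ?card_ord ?leq_pexp2l //.
by apply: Eq => //; rewrite -ltnS.
Qed.

End UnionBound.

(** * Explicit constants, and how small [zeta] must be *)

Section Constants.
Variables (R : realType) (C : R) (N : nat).
Hypothesis C0 : 0 < C.

(** The union bound costs [n ^ (N + 2)], and this exponent leaves [n ^ -2]. *)
Definition tail_exp : R := N%:R + 4.
(** Serves two purposes: it bounds the edges of one extension, and, times [ln n], those of all
    extensions in one moment. *)
Definition edge_const : R := (tail_exp + 2) * N%:R ^+ 2 + 1.
Definition drift_const : R := 4 * C * edge_const + 2 * edge_const ^+ 2.
Definition zeta_const : R := 16 * (C + edge_const + drift_const).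
Definition radius_const : R := N%:R * (tail_exp + 3) + 1.
Definition log_const : R := 2304 * tail_exp * edge_const *
  (expR 1 * (2 ^+ N * radius_const ^+ N)) * (edge_const + drift_const + 1).

Lemma tail_exp_gt0 : 0 < tail_exp. Proof. by rewrite ltr_wpDl. Qed.

Lemma edge_const_ge : N%:R ^+ 2 <= edge_const /\ 1 <= edge_const.
Proof.
have h : 0 <= N%:R ^+ 2 :> R by rewrite exprn_ge0.
have t : 1 <= tail_exp + 2 by have := ler0n R N; rewrite /tail_exp; lra.
have := ler_wpM2r h t; rewrite /edge_const; split; lra.
Qed.

Lemma drift_const_ge0 : 0 <= drift_const.
Proof.
have [_ e1] := edge_const_ge; have e0 : 0 <= edge_const by rewrite (le_trans _ e1).
by rewrite /drift_const addr_ge0 ?mulr_ge0 ?exprn_ge0 // ltW.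
Qed.

Lemma radius_const_ge1 : 1 <= radius_const.
Proof.
rewrite /radius_const lerDr mulr_ge0 //.
by have := ltW tail_exp_gt0; lra.
Qed.

Variable n : nat.
Let l : R := ln n%:R.
Hypotheses (n6 : (6 <= n)%N) (l1 : 1 <= l).
Hypotheses (lz : 16 * zeta_const <= l) (ll : log_const <= l).

(** Two more than the truncation, so that [expR (1 - r)] is at most [expR (- (tail_exp * l))]. *)
Definition moment_order : nat := (Num.truncn (tail_exp * l)).+2.
Definition moment_radius : nat := (N * moment_order.+1).+1.

Let n0 : (0 < n)%N. Proof. exact: leq_trans n6. Qed.
Let l0 : 0 < l. Proof. exact: lt_le_trans l1. Qed.

Lemma moment_order_ge : tail_exp * l + 1 <= moment_order%:R.
Proof.
rewrite /moment_order -natr1 lerD2r ltW // truncnS_gt //.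
Qed.

Lemma moment_order_le : moment_order%:R <= (tail_exp + 2) * l.
Proof.
have h : (Num.truncn (tail_exp * l))%:R <= tail_exp * l.
  by rewrite truncn_le mulr_ge0 ?ltW // tail_exp_gt0.
rewrite /moment_order -!natr1; move: h l1; lra.
Qed.

Lemma radius_le : moment_radius%:R <= radius_const * l.
Proof.
rewrite /moment_radius -natr1 natrM -natr1 /radius_const.
have h := moment_order_le.
have : N%:R * (moment_order%:R + 1) <= N%:R * ((tail_exp + 3) * l) :> R.
  by rewrite ler_wpM2l //; move: h l1; lra.
move: l1; lra.
Qed.

Variable i : nat.
Hypotheses (in2 : (i <= n ^ 2)%N) (pi0 : 0 < pp R n i).
Let z := zeta R n i.
Hypothesis zl : z * l ^+ 3 <= 1.

Let z0 : 0 < z. Proof. exact: zeta_gt0. Qed.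

(** One of the three logarithms in [zl] pays for the constant. The other two are for moments, whose
    drift is quadratic in [O(l)] edges. *)
Lemma zeta_const_log : 16 * zeta_const * (z * l ^+ 2) <= 1.
Proof.
apply: le_trans zl; rewrite [l ^+ 3]exprS [leRHS]mulrCA ler_wpM2r //.
by rewrite mulr_ge0 ?exprn_ge0 // ltW.
Qed.

Let zeta_small c : 0 <= c -> c <= zeta_const -> 16 * (c * (z * l ^+ 2)) <= 1.
Proof.
move=> c0 cz; apply: le_trans zeta_const_log; rewrite -mulrA ler_wpM2l // ler_wpM2r //.
by rewrite mulr_ge0 ?exprn_ge0 // ltW.
Qed.

Let zl2 : z <= z * l ^+ 2.
Proof. by rewrite ler_peMr ?exprn_ege1 // ltW. Qed.

Let e1 : 1 <= edge_const. Proof. by have [_] := edge_const_ge. Qed.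
Let d0 : 0 <= drift_const. Proof. exact: drift_const_ge0. Qed.

Lemma zeta_le1 : z <= 1.
Proof.
have := @zeta_small 1 ler01; rewrite /zeta_const.
have : 1 <= 16 * (C + edge_const + drift_const) by move: (ltW C0) e1 d0; lra.
move=> h /(_ h); move: zl2 (ltW z0); rewrite mul1r.
move: (z * l ^+ 2) => w; lra.
Qed.

Lemma C_zeta : C * z <= 2^-1.
Proof.
have h : C <= zeta_const by rewrite /zeta_const; move: (ltW C0) e1 d0; lra.
have := zeta_small (ltW C0) h.
have := ler_wpM2l (ltW C0) zl2; move: (C * z) (C * _) => a b; lra.
Qed.

Section Extension.
Variables (v : nat) (EH : {set {set 'I_v}}).
Hypotheses (vN : (v <= N)%N) (E2 : forall e, e \in EH -> #|e| = 2%N).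

Lemma card_edges_le : #|EH|%:R <= N%:R ^+ 2 :> R.
Proof.
rewrite -natrX ler_nat; apply: (@leq_trans 'C(v, 2)).
  rewrite -[v in 'C(v, 2)]card_ord -card_draws; apply: subset_leq_card.
  by apply/fintype.subsetP => e /E2 e2; rewrite inE e2.
rewrite bin2 -divn2; apply: leq_trans (leq_div _ _) _.
by rewrite -mulnn leq_mul // (leq_trans (leq_pred _)).
Qed.

Let e : R := #|EH|%:R.
Let K : R := 4 * C * e + 2 * e ^+ 2.

Let e0 : 0 <= e. Proof. exact: ler0n. Qed.
Let K0 : 0 <= K. Proof. by rewrite addr_ge0 ?mulr_ge0 ?exprn_ge0 // ltW. Qed.
Let eE : e <= edge_const.
Proof. by have [h _] := edge_const_ge; apply: le_trans h; exact: card_edges_le. Qed.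

Let drift_le c x : 0 <= c -> 1 <= x -> c <= edge_const * x ->
  4 * C * c + 2 * c ^+ 2 <= drift_const * x ^+ 2.
Proof.
move=> c0 x1 cx; have xx : 1 <= x ^+ 2 by rewrite exprn_ege1.
have x0 : 0 <= x by exact: le_trans x1.
rewrite /drift_const (mulrDl (4 * C * edge_const)); apply: lerD.
  rewrite -!mulrA ler_wpM2l // ler_wpM2l ?(ltW C0) //.
  by apply: le_trans cx _; rewrite ler_wpM2l ?(le_trans _ e1) // expr2 ler_peMl.
by rewrite -mulrA -exprMn ler_wpM2l // lerXn2r ?nnegrE // mulr_ge0 // (le_trans _ e1).
Qed.

Let KE : K <= drift_const.
Proof. by have := @drift_le e 1 e0 (lexx _); rewrite expr1n !mulr1; apply. Qed.

Lemma Psi_upper_tail J phi :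
  Prob (R := R) (fun s : seq (graph n) =>
    (forall j, (j < i)%N -> regular C j (nth (complete_graph n) s j)) /\
    expR 1 * ext_bound n EH J moment_radius (pp R n i) <=
      (Psi EH J phi (nth (complete_graph n) s i))%:R)
  <= expR (- (tail_exp * l)).
Proof.
have be : (moment_order * #|EH|)%N%:R <= edge_const * l.
  rewrite natrM; apply: (@le_trans _ _ ((tail_exp + 2) * l * N%:R ^+ 2)).
    by apply: ler_pM => //; [exact: moment_order_le | exact: card_edges_le].
  by rewrite mulrAC ler_wpM2r ?(ltW l0) // lerDl.
have zz0 : 0 <= z * l ^+ 2 by rewrite mulr_ge0 ?exprn_ge0 // ltW.
have zC : edge_const <= zeta_const /\ drift_const <= zeta_const.
  by rewrite /zeta_const; move: (ltW C0) e1 d0; split; lra.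
have edge0 : 0 <= edge_const by exact: le_trans e1.
have h1 := zeta_small edge0 zC.1; have h2 := zeta_small d0 zC.2.
apply: le_trans (Psi_upper phi (r := moment_order) n6 l1 (ltW C0) in2 pi0 _ _ _ _ _ _ E2) _.
- exact: C_zeta.
- exact: zeta_le1.
- apply: (@le_trans _ _ (edge_const * (z * l ^+ 2))); last by move: h1; lra.
  apply: (@le_trans _ _ (edge_const * l * z)); first by rewrite ler_wpM2r // ltW.
  rewrite -mulrA [l * z]mulrC ler_wpM2l // ler_wpM2l ?(ltW z0) //.
  by rewrite expr2 ler_peMl // ltW.
- have h := drift_le (ler0n _ _) l1 be.
  apply: (@le_trans _ _ (2 * (drift_const * l ^+ 2) * z)).
    by rewrite ler_wpM2r ?(ltW z0) // ler_wpM2l.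
  rewrite -(mulrA 2) -(mulrA drift_const) (mulrC (l ^+ 2) z); move: h2; move: (drift_const * _) => w; lra.
- by [].
- rewrite /moment_radius mulnS leqW // leq_add //; last by rewrite mulnC leq_mul2r vN orbT.
  by rewrite (leq_trans (max_card _)) // card_ord.
by rewrite ler_expR; have := moment_order_ge; lra.
Qed.

Let eKz : (e + K) * z <= 8^-1.
Proof.
have zC1 : e + K <= zeta_const.
  by apply: le_trans (lerD eE KE) _; rewrite /zeta_const; move: (ltW C0) e1 d0; lra.
have h := zeta_small (addr_ge0 e0 K0) zC1.
have : (e + K) * z <= (e + K) * (z * l ^+ 2) by rewrite ler_wpM2l // addr_ge0.
move: h; move: (_ * (z * _)) (_ * z) => a b; lra.
Qed.

Let kappa_le : 16 * (2 * K + 2 * e ^+ 2) <= 16 * zeta_const.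
Proof.
rewrite ler_wpM2l //.
have : e ^+ 2 <= drift_const.
  apply: le_trans KE; rewrite /K; have : 0 <= C * e by rewrite mulr_ge0 // ltW.
  have : 0 <= e ^+ 2 by rewrite exprn_ge0.
  lra.
by move: KE; rewrite /zeta_const; move: (ltW C0) e1 d0; lra.
Qed.

Let edge_le : 4 * edge_const <= 16 * zeta_const.
Proof. by rewrite /zeta_const; move: (ltW C0) e1 d0; lra. Qed.

Lemma deviation_tail (IH : {set 'I_v}) phi eps s : {in IH &, injective phi} ->
  0 < eps -> 0 < s -> 16 * zeta_const * z <= Num.min eps 1 ->
  l ^+ (v - #|IH| + 3) <= Num.min eps 1 * eps * s ->
  (forall a (W : {set 'I_v}), a \in EH -> IH :|: a \subset W ->
    s <= n%:R ^+ (#|W| - #|IH|) * pp R n i ^+ inner EH W) ->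
  Prob (R := R) (fun s' : seq (graph n) =>
    (forall j, (j < i)%N -> regular C j (nth (complete_graph n) s' j) /\
       forall J phi', (Psi EH J phi' (nth (complete_graph n) s' j))%:R <=
          expR 1 * ext_bound n EH J moment_radius (pp R n j)) /\
    eps < `|(Psi EH IH phi (nth (complete_graph n) s' i))%:R / scaling n EH IH i - 1|) <=
  2 * expR (- (tail_exp * l)).
Proof.
move=> phiI eps0 s0 mz big sW.
have sn0 : 0 < Num.sqrt n%:R :> R by rewrite sqrtr_gt0 ltr0n.
have sn1 : 1 <= Num.sqrt n%:R :> R.
  by rewrite -[leLHS]sqrtr1 ler_wsqrtr // ler1n.
have nsq : n%:R = Num.sqrt n%:R * Num.sqrt n%:R :> R by rewrite -expr2 sqr_sqrtr.
have zE : z * (Num.sqrt n%:R * pp R n i) = l.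
  by rewrite /z /zeta divfK // gt_eqF // mulr_gt0.
have n1s : n%:R^-1 <= (Num.sqrt n%:R)^-1 :> R.
  by rewrite lef_pV2 ?posrE ?ltr0n // [leRHS]nsq ler_peMl // ltW.
have zn : n%:R^-1 <= z.
  apply: le_trans n1s _; rewrite -[leLHS]mul1r ler_pdivrMr //.
  apply: le_trans l1 _; rewrite -zE mulrA ler_piMr ?pp_le1 // mulr_ge0 ?ltW //.
(* [zeta <= 1] already forces [p] to be at least [ln n / sqrt n]. *)
have pn : n%:R^-1 <= pp R n i.
  apply: le_trans n1s _; rewrite -[leLHS]mul1r ler_pdivrMr //.
  apply: le_trans l1 _; rewrite -zE [pp _ _ _ * _]mulrC ler_piMl ?zeta_le1 //.
  by rewrite mulr_ge0 ?ltW.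
have zz0 : 0 <= z * l ^+ 2 by rewrite mulr_ge0 ?exprn_ge0 // ltW.
have edge0 : 0 <= edge_const by exact: le_trans e1.
apply: (deviation _ _ _ _ _ _ _ _ _ _ _ _ eps0 s0 _ _ _ _ sW) => //.
- exact: ltW.
- exact: C_zeta.
- exact: zeta_le1.
- exact: tail_exp_gt0.
- rewrite -/e -/K ler_pdivlMr //; apply: le_trans mz.
  by rewrite mulrC mulrA ler_wpM2r ?(ltW z0).
- rewrite ler_pdivlMr // mulrC; apply: le_trans mz.
  apply: (@le_trans _ _ (4 * (edge_const * z))); last by rewrite mulrA ler_wpM2r ?(ltW z0).
  rewrite ler_wpM2l //; apply: ler_pM => //; rewrite ?exprn_ge0 ?invr_ge0 //.
  have [h _] := edge_const_ge; apply: le_trans h.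
  by rewrite lerXn2r ?nnegrE // ler_nat.
rewrite -/e -/K; apply: (le_trans _ big); clear big sW.
set k := (v - #|IH|)%N.
have kN : (k <= N)%N by rewrite (leq_trans (leq_subr _ _)).
have r0 : 0 <= radius_const by rewrite (le_trans ler01) // radius_const_ge1.
have U : expR 1 * (2 ^+ v * moment_radius%:R ^+ k) <=
    expR 1 * (2 ^+ N * radius_const ^+ N) * l ^+ k.
  rewrite -!mulrA ler_wpM2l ?expR_ge0 //; apply: ler_pM; rewrite ?exprn_ge0 //.
    by rewrite ler_weXn2l // ler1n.
  apply: (@le_trans _ _ ((radius_const * l) ^+ k)).
    by rewrite lerXn2r ?nnegrE ?radius_le // mulr_ge0 // ltW.
  rewrite exprMn ler_wpM2r ?exprn_ge0 ?(ltW l0) //.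
  by rewrite ler_weXn2l // radius_const_ge1.
apply: (@le_trans _ _ (2304 * tail_exp * edge_const *
  (expR 1 * (2 ^+ N * radius_const ^+ N) * l ^+ k) * (edge_const + drift_const + 1) * l ^+ 2)).
  have c0 : 0 <= 2304 * tail_exp by apply: mulr_ge0; [exact: ler0n | exact/ltW/tail_exp_gt0].
  have U0 : 0 <= expR 1 * (2 ^+ v * moment_radius%:R ^+ k) :> R.
    by apply: mulr_ge0; [exact: expR_ge0 | rewrite mulr_ge0 ?exprn_ge0].
  move: (2304 * tail_exp) c0 (expR 1 * _) U0 U => c c0 U' U0 U.
  apply: ler_wpM2r; first by rewrite exprn_ge0 // ltW.
  apply: ler_pM.
  - by apply: mulr_ge0 => //; exact: mulr_ge0.
  - by rewrite addr_ge0 // addr_ge0.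
  - by apply: ler_pM => //; [exact: mulr_ge0 | exact: ler_wpM2l].
  - by rewrite lerD2r lerD.
(* The third extra logarithm in [l ^+ (k + 3)] is there to absorb [log_const]. *)
rewrite (_ : _ * l ^+ 2 = log_const * (l ^+ k * l ^+ 2)); last first.
  by rewrite /log_const; move: (expR 1 * _) (l ^+ k) (l ^+ 2) => a b c; ring.
by rewrite -exprD (addnS k 2) [leRHS]exprS ler_wpM2r // exprn_ge0 // ltW.
Qed.

End Extension.
End Constants.

(** * Scalings of balanced extensions *)

Lemma powR_expR (R : realType) (a x : R) : 0 < a -> powR a x = expR (x * ln a).
Proof. by move=> a0; rewrite /powR gt_eqF. Qed.

Section Cases.
Variables (R : realType) (C : R) (N n i : nat).
Hypotheses (C0 : 0 < C) (N0 : (0 < N)%N).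

(** This is the square root of the final [delta]. The cube comes from the strictly balanced case,
    which needs [4 * d * N ^ 3 <= 1]. *)
Definition root_delta : R := (4 * (N%:R + 2) ^+ 3)^-1.
(** Solves [d * log_power = 2 * N * (N + 4)]: then [zeta ^ -(d / (2 * N))] exceeds [l ^ (N + 4)], as
    stated in [dw]. *)
Definition log_power : nat := (8 * N * (N + 4) * (N + 2) ^ 3)%N.

Let d := root_delta.
Let l : R := ln n%:R.
Hypotheses (n6 : (6 <= n)%N) (l2 : 2 <= l) (lz : 16 * zeta_const C N <= l).
Hypothesis pi0 : 0 < pp R n i.
Let p := pp R n.
Let z := zeta R n.
Hypothesis zl : z i * l ^+ log_power <= 1.

Let n0 : (0 < n)%N. Proof. exact: leq_trans n6. Qed.
Let nR : 0 < n%:R :> R. Proof. by rewrite ltr0n. Qed.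
Let l1 : 1 <= l. Proof. by move: l2; lra. Qed.
Let l0 : 0 < l. Proof. by move: l2; lra. Qed.
Let NR : 1 <= N%:R :> R. Proof. by rewrite ler1n. Qed.

Let cube : 1 <= (N%:R + 2) ^+ 3 :> R /\ N%:R ^+ 3 <= (N%:R + 2) ^+ 3 :> R /\
  N%:R <= (N%:R + 2) ^+ 3 :> R.
Proof.
move: NR; move: (N%:R) => a a1; split; last split.
- by rewrite exprn_ege1 //; lra.
- by rewrite lerXn2r ?nnegrE; lra.
- rewrite (@le_trans _ _ (a + 2)) ?lerDl // exprS ler_peMr ?exprn_ege1 //; lra.
Qed.

Let d0 : 0 < d.
Proof. by rewrite invr_gt0 mulr_gt0 // (lt_le_trans ltr01) //; have [] := cube. Qed.

Let dE : d * (4 * (N%:R + 2) ^+ 3) = 1.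
Proof. by rewrite mulVf // gt_eqF // mulr_gt0 // (lt_le_trans ltr01) //; have [] := cube. Qed.

Let dN : 4 * (d * N%:R) <= 1.
Proof.
rewrite -[leRHS]dE [leRHS]mulrCA ler_wpM2l // ler_wpM2l ?(ltW d0) //; by have [_ []] := cube.
Qed.

Let dN3 : 4 * (d * N%:R ^+ 3) <= 1.
Proof.
rewrite -[leRHS]dE [leRHS]mulrCA ler_wpM2l // ler_wpM2l ?(ltW d0) //; by have [_ []] := cube.
Qed.

Let d4 : d <= 4^-1.
Proof.
have : d <= d * N%:R by rewrite ler_peMr // ltW.
by move: dN; lra.
Qed.

Let pj j : (j <= i)%N -> 0 < p j.
Proof. by move=> ji; exact: lt_le_trans pi0 (pp_anti R n ji). Qed.

Let z0 j : (j <= i)%N -> 0 < z j.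
Proof. by move=> ji; apply: zeta_gt0 => //; exact: pj. Qed.

(** In logarithms all comparisons of scalings become linear in [l], [q] and [w], with [wE] as the
    only relation. *)
Let q j := ln (p j).
Let w j := - ln (z j).

Let q_le0 j : q j <= 0. Proof. exact: ln_le0 (pp_le1 _ _ _). Qed.

Let wE j : (j <= i)%N -> w j = l / 2 + q j - ln l.
Proof.
move=> ji; have p0 := pj ji.
have s0 : 0 < Num.sqrt n%:R :> R by rewrite sqrtr_gt0.
have hs : l = ln (Num.sqrt n%:R) + ln (Num.sqrt n%:R).
  by rewrite -lnM ?posrE // -expr2 sqr_sqrtr ?ler0n.
rewrite /w /z /zeta ln_div ?posrE ?mulr_gt0 // lnM ?posrE // -/(p j) -/l -/(q j).
move: hs; rewrite -/(q j); move: (ln (Num.sqrt _)) => a; lra.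
Qed.

Let lnl0 : 0 <= ln l. Proof. exact: ln_ge0. Qed.

Let w_anti j : (j <= i)%N -> w i <= w j.
Proof.
by move=> ji; rewrite lerN2 ler_ln ?posrE ?z0 // zeta_mono.
Qed.

Let M_ge2 : (2 <= log_power)%N.
Proof.
rewrite /log_power -!mulnA (leq_trans _ (leq_pmulr 8 _)) //.
by rewrite muln_gt0 N0 muln_gt0 addn_gt0 N0 expn_gt0 addn_gt0 N0.
Qed.

Let w_ge : log_power%:R * ln l <= w i.
Proof.
have := ln_le0 zl; rewrite lnM ?posrE ?exprn_gt0 ?z0 // lnXn // => h.
by rewrite /w mulr_natl -subr_le0 opprK addrC.
Qed.

Let Md : d * log_power%:R = 2 * N%:R * (N%:R + 4).
Proof.
rewrite /log_power natrM natrX natrM natrM !natrD.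
rewrite (_ : _ * _ = (d * (4 * (N%:R + 2) ^+ 3)) * (2 * N%:R * (N%:R + 4))); last by ring.
by rewrite dE mul1r.
Qed.

Let w_ge0 : 0 <= w i.
Proof. by apply: le_trans w_ge; rewrite mulr_ge0. Qed.

Let dw : (N%:R + 4) * ln l <= d / (2 * N%:R) * w i.
Proof.
apply: (@le_trans _ _ (d / (2 * N%:R) * (log_power%:R * ln l))).
  rewrite mulrA (_ : d / _ * _ = N%:R + 4) // mulrAC Md mulrAC divff ?mul1r //.
  by rewrite mulf_neq0 // gt_eqF // (lt_le_trans ltr01).
by rewrite ler_wpM2l // divr_ge0 ?mulr_ge0 // ltW.
Qed.

Let zeta_pow : 16 * zeta_const C N * z i <= expR (- (d ^+ 2 * w i)).
Proof.
apply: (@le_trans _ _ (l * z i)); first by rewrite ler_wpM2r // ltW // z0.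
have -> : l * z i = expR (ln (l * z i)) by rewrite lnK // posrE mulr_gt0 // z0.
rewrite ler_expR lnM ?posrE ?z0 //.
have h1 : 2 * ln l <= w i.
  by apply: le_trans w_ge; rewrite ler_wpM2r // ler_nat.
have h2 : d ^+ 2 * w i <= 2^-1 * w i.
  rewrite ler_wpM2r // expr2; have := ler_pM (ltW d0) (ltW d0) d4 d4; lra.
move: h1 h2; rewrite /w; move: (ln (z i)) (ln l) (d ^+ 2 * _) => a b c; lra.
Qed.

Section Extension.
Variables (v : nat) (EH : {set {set 'I_v}}) (IH : {set 'I_v}).
Hypotheses (vN : (v <= N)%N) (ext : is_ext EH IH).
Let S j := scaling (R := R) n EH IH j.
Let k := (v - #|IH|)%N.
Let e := #|EH|.

Let E2 a : a \in EH -> #|a| = 2%N. Proof. by have [h _] := ext; exact: h. Qed.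

Let ln_monom j a b : (j <= i)%N -> ln (n%:R ^+ a * p j ^+ b) = a%:R * l + b%:R * q j.
Proof.
by move=> ji; have p0 := pj ji; rewrite lnM ?posrE ?exprn_gt0 // !lnXn ?posrE // !mulr_natl.
Qed.

Let monom_gt0 j a b : (j <= i)%N -> 0 < n%:R ^+ a * p j ^+ b :> R.
Proof. by move=> ji; rewrite mulr_gt0 ?exprn_gt0 ?pj. Qed.

Let S0 j : (j <= i)%N -> 0 < S j. Proof. exact: monom_gt0. Qed.
Let lnS j : (j <= i)%N -> ln (S j) = k%:R * l + e%:R * q j.
Proof. exact: ln_monom. Qed.

Let kN : (k <= N)%N. Proof. by rewrite (leq_trans (leq_subr _ _)). Qed.
Let eN : e%:R <= N%:R ^+ 2 :> R. Proof. exact: card_edges_le vN E2. Qed.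

(** [le_tmin i] speaks only of steps before [i]; this carries the information over the last step at
    the price of a factor [2]. *)
Let shrink j m : (j.+1 = i)%N -> (m <= e)%N -> p j ^+ m <= 2 * p i ^+ m.
Proof.
move=> ji me; have jlei : (j <= i)%N by rewrite -ji.
have p0 := pj jlei; have p1 : 0 < pp R n j.+1 by rewrite ji.
rewrite -ji /p ppS // exprMn mulrCA ler_peMr ?exprn_ge0 ?(ltW p0) //.
have x0 := rate_gt0 n0 p0; have x1 := rate_lt1 n0 p0 p1.
have zl3 : z i * l ^+ 3 <= 1.
  apply: le_trans zl; rewrite ler_wpM2l ?(ltW (z0 (leqnn i))) // ler_weXn2l //.
  rewrite /log_power (leq_trans _ (leq_pmulr _ _)) ?expn_gt0 ?addn_gt0 ?N0 //.
  by rewrite (leq_trans _ (leq_pmulr _ _)) ?addn_gt0 ?N0 // (leq_trans _ (leq_pmulr _ _)).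
have zC := zeta_const_log n6 l1 lz pi0 zl3.
have mx : m%:R * rate R n j <= 2^-1.
  apply: (@le_trans _ _ (edge_const R N * z i)).
    apply: ler_pM => //; first exact: ltW.
      by have [h _] := edge_const_ge R N; apply: le_trans h; apply: le_trans eN; rewrite ler_nat.
    apply: le_trans (zeta_mono n0 l1 jlei pi0).
    apply: rate_le_zeta => //; apply: le_trans (zeta_mono n0 l1 jlei pi0) _.
    exact: (zeta_le1 C0 n6 l1 lz pi0 zl3).
  have h : 2 * edge_const R N <= 16 * zeta_const C N.
    have [_ h1] := edge_const_ge R N; have := drift_const_ge0 N C0.
    by rewrite /zeta_const; move: (ltW C0) h1; lra.
  have h1 : 2 * edge_const R N * z i <= 1.
    apply: le_trans zC; apply: ler_pM => //.
    - by rewrite mulr_ge0 // (le_trans ler01) //; have [] := edge_const_ge R N.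
    - by rewrite ltW // z0.
    - by rewrite ler_peMr ?exprn_ege1 // ltW // z0.
  move: h1; rewrite -mulrA; move: (_ * z i) => y; lra.
have x01 : 0 <= rate R n j <= 1 by rewrite !ltW.
have h := bernoulli m x01.
apply: (@le_trans _ _ (2 * (1 - m%:R * rate R n j))); last by rewrite ler_wpM2l.
by move: mx; move: (_ * rate _ _ _) => y; lra.
Qed.

Let card_IH_W a (W : {set 'I_v}) : a \in EH -> IH :|: a \subset W ->
  (0 < #|W| - #|IH|)%N /\ (#|W| - #|IH| <= k)%N.
Proof.
move=> aE JW; have [_ h] := ext; split; last first.
  by rewrite leq_sub2r // (leq_trans (max_card _)) // card_ord.
rewrite subn_gt0; apply: proper_card; rewrite properE.
rewrite (fintype.subset_trans (finset.subsetUl _ _) JW) /=.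
apply: contra (h _ aE) => WI; apply: fintype.subset_trans WI.
exact: (fintype.subset_trans (finset.subsetUr _ _) JW).
Qed.

Let inner_subext (W : {set 'I_v}) : IH \subset W ->
  is_subext EH IH W [set a in EH | a \subset W].
Proof.
move=> IW; split=> //; split; last by move=> a; rewrite inE => /andP[].
by apply/fintype.subsetP => a; rewrite inE => /andP[].
Qed.

Let sub_IW a (W : {set 'I_v}) : IH :|: a \subset W -> IH \subset W.
Proof. by apply: fintype.subset_trans; exact: finset.subsetUl. Qed.

(* Balancedness of [H] says that, as long as [S_H >= 1], the scaling of any
   subextension spanning an edge is at least a fixed power of [S_H]. *)
Lemma balanced_conditions :
  balanced (R := R) EH IH ->
  le_tmin i (fun j => 0 < p j /\ S j <= powR (z j) (- d)) ->
  let eps := powR (z i) (d ^+ 2) in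
  let s := powR (z i) (- (d / N%:R)) / 2 in
  [/\ 0 < eps, 0 < s, 16 * zeta_const C N * z i <= Num.min eps 1,
    l ^+ (k + 3) <= Num.min eps 1 * eps * s &
    forall a (W : {set 'I_v}), a \in EH -> IH :|: a \subset W ->
      s <= n%:R ^+ (#|W| - #|IH|) * p i ^+ inner EH W].
Proof.
move=> bal early eps s.
have zi := z0 (leqnn i).
have epsE : eps = expR (- (d ^+ 2 * w i)) by rewrite /eps powR_expR // /w mulrN opprK.
have sE : s = expR (d / N%:R * w i) / 2 by rewrite /s powR_expR // /w mulNr mulrN.
have eps1 : eps <= 1.
  by rewrite epsE -expR0 ler_expR oppr_le0 mulr_ge0 // exprn_ge0 // ltW.
have mE : Num.min eps 1 = eps by apply/min_idPl.
split.
- by rewrite epsE expR_gt0.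
- by rewrite sE divr_gt0 ?expR_gt0.
- by rewrite mE epsE zeta_pow.
(* Here [eps ^ 2 * s] is half of [zeta ^ (2 * d ^ 2 - d / N)]. As [4 * d * N <= 1], a power
   [zeta ^ -(d / (2 * N))] is left over, which beats the logarithms by [dw]. *)
- rewrite mE epsE sE mulrA -!expRD ler_pdivlMr //.
  have k4 : l ^+ (k + 3) * 2 <= l ^+ (N + 4).
    apply: (@le_trans _ _ (l ^+ (k + 3) * l)); first by rewrite ler_wpM2l // exprn_ge0 // ltW.
    by rewrite -exprSr ler_weXn2l // -addnS leq_add2r.
  apply: (le_trans k4); rewrite -[l ^+ _]lnK ?posrE ?exprn_gt0 // ler_expR.
  rewrite lnXn // -[leLHS]mulr_natl natrD; apply: (le_trans dw).
  have h : 2 * d ^+ 2 <= d / (2 * N%:R).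
    rewrite ler_pdivlMr; last by rewrite mulr_gt0 // (lt_le_trans ltr01).
    have := ler_wpM2l (ltW d0) dN; rewrite expr2; lra.
  have hh : d / N%:R = 2 * (d / (2 * N%:R)).
    by field; rewrite gt_eqF // (lt_le_trans ltr01).
  have := ler_wpM2r w_ge0 h; rewrite hh; move: (d / (2 * N%:R)) (d ^+ 2) => a b; lra.
move=> a W aE JW; have [W0 Wk] := card_IH_W aE JW.
have k0 : (0 < k)%N by exact: leq_trans Wk.
have IW := sub_IW JW.
set m := (#|W| - #|IH|)%N in W0 Wk *; set b := inner EH W.
have be : (b <= e)%N by exact: inner_le.
(* At time [0] there is no earlier step to draw on, but [p = 1] and [W] has a free vertex. *)
have [i0|] := posnP i.
  rewrite i0 /p pp0 expr1n mulr1.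
  have : s <= n%:R.
    rewrite sE ler_pdivrMr // -[n%:R]lnK ?posrE //.
    apply: (@le_trans _ _ (expR (ln n%:R) * 1)); last by rewrite ler_wpM2l ?expR_ge0 // ler1n.
    rewrite mulr1 ler_expR -/l.
    have h1 : d / N%:R <= 1.
      rewrite ler_pdivrMr ?mul1r ?(lt_le_trans ltr01) //.
      by move: NR d4; lra.
    have h2 : d / N%:R * w i <= w i by rewrite ler_piMl.
    have h3 := wE (leqnn i); have := q_le0 i; move: h2 h3 lnl0 l0; lra.
  move/le_trans; apply; rewrite -[leLHS]expr1 ler_weXn2l // ler1n //.
move=> i_gt0; have [j ji] : exists j, (j.+1 = i)%N by exists i.-1; rewrite prednK.
have jlei : (j <= i)%N by rewrite -ji.
have lnSj : d * w j <= ln (S j).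
  rewrite -ler_expR lnK ?posrE ?S0 //.
  rewrite leNgt; apply/negP => Sj; apply: (early j); first by rewrite -ji.
  by split; [exact: pj | rewrite powR_expR ?z0 // mulNr -mulrN ltW].
have bm : b%:R * k%:R <= e%:R * m%:R :> R.
  have := bal _ _ (inner_subext IW); rewrite /density -/m -/k -/b -/e.
  by rewrite ler_pdivrMr ?ltr0n // mulrAC ler_pdivlMr ?ltr0n.
have wj0 : 0 <= w j by apply: le_trans (w_anti jlei).
pose T := ln (n%:R ^+ m * p j ^+ b).
have TE : T = m%:R * l + b%:R * q j by exact: ln_monom.
(* Since [q <= 0], the inequality [b * k <= e * m] gives [m * ln (S j) <= k * T]. *)
have kT : d * w j <= k%:R * T.
  apply: (le_trans lnSj); apply: (@le_trans _ _ (m%:R * ln (S j))).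
    by rewrite ler_peMl ?ler1n // (le_trans _ lnSj) // mulr_ge0 // ltW.
  rewrite lnS // TE; have := ler_wnM2r (q_le0 j) bm; lra.
have T0 : 0 <= T.
  by rewrite -(@pmulr_rge0 _ k%:R) ?ltr0n // (le_trans _ kT) // mulr_ge0 // ltW.
have dT : d / N%:R * w i <= T.
  rewrite mulrAC ler_pdivrMr ?(lt_le_trans ltr01) //.
  apply: (@le_trans _ _ (d * w j)); first by rewrite ler_wpM2l ?w_anti // ltW.
  by apply: (le_trans kT); rewrite [leRHS]mulrC ler_wpM2r ?ler_nat //.
rewrite sE ler_pdivrMr //; apply: (@le_trans _ _ (n%:R ^+ m * p j ^+ b)).
  by rewrite -[leRHS]lnK ?posrE ?monom_gt0 // ler_expR.
rewrite -mulrA ler_wpM2l ?exprn_ge0 // mulrC.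
exact: shrink ji be.
Qed.

(** Now [S i] itself has to bound the scalings from below. Strictness yields an integral gap
    [b * k + 1 <= e * m], which gains a factor [1 / p]. As [S i] is at most a small power of [n],
    [1 / p] must be a definite power of [n] and outweighs what is lost. *)
Lemma strictly_balanced_conditions :
  strictly_balanced (R := R) EH IH ->
  ge_tmin i (fun j => 0 < p j /\ S j <= powR (z j) (- d)) ->
  le_tmin i (fun j => 0 < p j /\ S j <= 1) ->
  let eps := powR (S i) (- d) * powR l (3 * expR k%:R) in
  [/\ 0 < eps, 0 < S i, 16 * zeta_const C N * z i <= Num.min eps 1,
    l ^+ (k + 3) <= Num.min eps 1 * eps * S i &
    forall a (W : {set 'I_v}), a \in EH -> IH :|: a \subset W ->
      S i <= n%:R ^+ (#|W| - #|IH|) * p i ^+ inner EH W].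
Proof.
move=> sbal late early eps.
have Si := S0 (leqnn i); have zi := z0 (leqnn i).
pose sg := ln (S i).
have SiE : S i = expR sg by rewrite lnK.
have sgE : sg = k%:R * l + e%:R * q i by exact: lnS.
have wi : w i <= l / 2.
  by have := wE (leqnn i); have := q_le0 i; move: lnl0; lra.
have qi : - (l / 2) <= q i.
  by have := wE (leqnn i); move: w_ge0 lnl0; lra.
have [j ji lnSj] : exists2 j, (j <= i)%N & ln (S j) <= d * w j.
  have [j [ji [_ Sj]]] := late; exists j => //.
  by rewrite -ler_expR lnK ?posrE ?S0 // (le_trans Sj) // powR_expR ?z0 // mulNr -mulrN.
have wj : w j <= l / 2.
  by have := wE ji; have := q_le0 j; move: lnl0; lra.
(* An extension without edges never reaches scaling [zeta^-d]. *)
have e1 : (0 < k)%N -> (0 < e)%N.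
  move=> k0; rewrite lt0n; apply/eqP => e0.
  move: lnSj; rewrite lnS // e0 mul0r addr0.
  have h1 : l <= k%:R * l by rewrite ler_peMl ?ler1n // ltW.
  have h2 := ler_wpM2l (ltW d0) wj.
  have h3 : d * (l / 2) <= 4^-1 * (l / 2) by rewrite ler_wpM2r ?d4 // divr_ge0 // ltW.
  by move: h1 h2 h3 l0; lra.
have e00 : k = 0%N -> e = 0%N.
  move=> k0; rewrite /e; apply/eqP; rewrite cards_eq0 -finset.subset0; apply/fintype.subsetP => a aE.
  have [h1 h2] := card_IH_W aE (fintype.subxx (IH :|: a)).
  by have := leq_trans h1 h2; rewrite k0.
(* Up to powers of [n] and [ln n], [S * zeta ^ d] is [p ^ (e - d)], which decreases once [e >= 1];
   hence the bound at [j] persists until [i]. *)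
have sg_le : sg <= d * w i.
  case: (posnP k) => [k0|/e1 e0].
    rewrite sgE k0 (e00 k0) !mul0r addr0 mulr_ge0 // ltW //.
  have e1R : 1 <= e%:R :> R by rewrite ler1n.
  have qij : q i <= q j by rewrite ler_ln ?posrE ?pj // pp_anti.
  have h : (e%:R - d) * (q i - q j) <= 0.
    by rewrite mulr_ge0_le0 ?subr_le0 // subr_ge0; move: d4 e1R; lra.
  rewrite sgE; move: lnSj; rewrite lnS // (wE ji) (wE (leqnn i)).
  move: h; lra.
have sg_ge : - ln 2 <= sg.
  have [i0|] := posnP i.
    rewrite sgE i0 /q /p pp0 ln1 mulr0 addr0 (@le_trans _ _ 0) ?oppr_le0 ?ln_ge0 ?ler1n //.
    by rewrite mulr_ge0 // ltW.
  move=> i_gt0; have [j' ji'] : exists j, (j.+1 = i)%N by exists i.-1; rewrite prednK.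
  have jlei : (j' <= i)%N by rewrite -ji'.
  have Sj1 : 1 <= S j'.
    rewrite leNgt; apply/negP => Sj; apply: (early j'); first by rewrite -ji'.
    by split; [exact: pj | exact: ltW].
  rewrite -lnV ?posrE // /sg ler_ln ?posrE //.
  have : S j' <= 2 * S i.
    rewrite /S /scaling mulrCA ler_wpM2l ?exprn_ge0 //; exact: shrink ji' (leqnn e).
  by move: Sj1; lra.
have epsE : eps = expR (- (d * sg)) * powR l (3 * expR k%:R).
  by rewrite /eps powR_expR // -/sg mulNr.
(* Where the exponent is used: [k + 4 <= 3 * (1 + k) <= 3 * expR k] for [k >= 1], with one logarithm
   spent on the factor [2]. *)
have k3 : (0 < k)%N -> l ^+ (k + 3) <= powR l (3 * expR k%:R) / 2.
  move=> k0; rewrite ler_pdivlMr //; apply: (@le_trans _ _ (l ^+ (k + 3) * l)).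
    by rewrite ler_wpM2l // exprn_ge0 // ltW.
  have E (a b : R) : 1 <= a -> 1 + a <= b -> a + 4 <= 3 * b by move=> a1 ab; lra.
  rewrite -exprSr -powR_mulrn ?(ltW l0) // ler_powR // -addnS natrD.
  by apply: E; rewrite ?ler1n ?expR_ge1Dx.
have rho1 : 1 <= powR l (3 * expR k%:R).
  rewrite powR_expR // -expR0 ler_expR mulr_ge0 // mulr_ge0 ?expR_ge0 //.
have eps0 : 0 < eps by rewrite epsE mulr_gt0 ?expR_gt0 // (lt_le_trans ltr01).
have zC : 16 * zeta_const C N * z i <= Num.min eps 1.
  rewrite le_min; apply/andP; split; apply: (le_trans zeta_pow).
    rewrite epsE -[leLHS]mulr1; apply: ler_pM; rewrite ?expR_ge0 //.
    rewrite ler_expR lerN2 expr2 -mulrA ler_wpM2l // ltW //.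
  by rewrite -expR0 ler_expR oppr_le0 mulr_ge0 // exprn_ge0 // ltW.
split=> //.
- case: (posnP k) => [k0|k0].
    have sg0 : sg = 0 by rewrite sgE k0 (e00 k0) !mul0r addr0.
    have eps3 : eps = l ^+ 3.
      by rewrite epsE sg0 mulr0 oppr0 expR0 mul1r k0 expR0 mulr1 powR_mulrn // ltW.
    rewrite SiE sg0 expR0 mulr1 k0 add0n (_ : Num.min eps 1 = 1) ?mul1r ?eps3 //.
    by apply/min_idPr; rewrite exprn_ege1.
  apply: (le_trans (k3 k0)).
  have ln2 : 0 <= ln 2 :> R by rewrite ln_ge0 // ler1n.
  have dsg c : 0 <= c -> c <= 1 -> 2^-1 <= expR (c * sg).
    move=> c0 c1; rewrite -[leLHS]lnK ?posrE ?invr_gt0 // ler_expR lnV ?posrE //.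
    apply: (@le_trans _ _ (c * - ln 2)); last by rewrite ler_wpM2l.
    by rewrite mulrN lerN2 ler_piMl.
  have P0 : 0 <= powR l (3 * expR k%:R) by exact: powR_ge0.
  (* The scaling enters as its power [1 - 2 * d] or [1 - d]. Both exponents lie in [[0, 1]], so
     [S i >= 1/2] costs at most a factor [2]. *)
  have [eps1|eps1] := leP eps 1.
    rewrite SiE epsE.
    have -> (a b g : R) : a * b * (a * b) * g = a * a * g * (b * b) by ring.
    rewrite -!expRD (_ : _ + _ + _ = (1 - 2 * d) * sg); last by ring.
    rewrite [leLHS]mulrC; apply: ler_pM => //; last by rewrite ler_peMl.
    by apply: dsg; move: d4 (ltW d0); lra.
  rewrite mul1r SiE epsE mulrAC -expRD (_ : _ + _ = (1 - d) * sg); last by ring.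
  rewrite [leLHS]mulrC ler_wpM2r //.
  by apply: dsg; move: d4 (ltW d0); lra.
move=> a W aE JW; have [W0 Wk] := card_IH_W aE JW.
have k0 : (0 < k)%N by exact: leq_trans Wk.
have IW := sub_IW JW; have WE := inner_subext IW.
set m := (#|W| - #|IH|)%N in W0 Wk *; set b := inner EH W.
have mR : 1 <= m%:R :> R by rewrite ler1n.
have mk : m%:R <= k%:R :> R by rewrite ler_nat.
have kR : 0 < k%:R :> R by rewrite ltr0n.
have sg2 : sg <= d * (l / 2) by apply: (le_trans sg_le); rewrite ler_wpM2l // ltW.
have goal_ln : sg <= m%:R * l + b%:R * q i -> S i <= n%:R ^+ m * p i ^+ b.
  move=> h; rewrite SiE -[leRHS]lnK ?posrE ?monom_gt0 // ler_expR.
  by rewrite ln_monom.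
apply: goal_ln.
have [EW|EW] := eqVneq [set a in EH | a \subset W] EH; last first.
  have bm : b%:R * k%:R + 1 <= e%:R * m%:R :> R.
    have := sbal _ _ WE EW; rewrite /density -/m -/k -/b -/e.
    rewrite ltr_pdivrMr ?ltr0n // mulrAC ltr_pdivlMr ?ltr0n //.
    by rewrite -!natrM ltr_nat natr1 ler_nat.
  rewrite -(ler_pM2l kR).
  have h1 := ler_wnM2r (q_le0 i) bm.
  (* The left side is at most [N * d * l / 2], whereas [e * - q = k * l - sg] with [e <= N ^ 2]
     makes [- q] at least about [l / N ^ 2]; this is where [4 * d * N ^ 3 <= 1] enters. *)
  have h2 : (k%:R - m%:R) * sg <= - q i.
    have km0 : 0 <= k%:R - m%:R :> R by rewrite subr_ge0.
    have [sg0|sg0] := leP sg 0.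
      by rewrite (@le_trans _ _ 0) ?mulr_ge0_le0 // oppr_ge0.
    have kmN : k%:R - m%:R <= N%:R :> R.
      by rewrite lerBlDr (@le_trans _ _ N%:R) ?ler_nat // lerDl.
    have h3 : (k%:R - m%:R) * sg <= N%:R * (d * (l / 2)).
      by apply: ler_pM => //; exact: ltW.
    apply: (le_trans h3).
    have e1N : 0 < N%:R ^+ 2 :> R by rewrite exprn_gt0 // (lt_le_trans ltr01).
    rewrite -(ler_pM2l e1N).
    have h4 : e%:R * - q i <= N%:R ^+ 2 * - q i by rewrite ler_wpM2r // oppr_ge0.
    have h5 : l <= k%:R * l by rewrite ler_peMl ?ler1n // ltW.
    have h6 : N%:R ^+ 3 * d * l <= 4^-1 * l.
      rewrite ler_wpM2r ?(ltW l0) // [leLHS]mulrC.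
      by move: dN3; move: (d * N%:R ^+ 3) => y; lra.
    have h7 : d * l <= 4^-1 * l by rewrite ler_wpM2r ?(ltW l0).
    move: sg2 h4 h5 h6 h7 l0; rewrite sgE; move: (N%:R) => NN; lra.
  rewrite mulrDr mulrA mulrA; move: h1 h2; rewrite sgE; lra.
have bE : b = e by rewrite /b /inner EW.
have [mk'|mk'] := eqVneq m k; first by rewrite mk' bE sgE.
(* Otherwise [H] has isolated free vertices; strict balancedness then forces
   [e < k], so that [S_H >= n^(k/2)] cannot be as small as [zeta^-d]. *)
exfalso.
have mk1 : (m < k)%N by rewrite ltn_neqAle mk' Wk.
have sub1 : is_subext EH IH W (EH :\ a).
  split=> //; split; first exact: finset.subsetDl.
  move=> f; rewrite !inE => /andP[_]; rewrite -EW inE => /andP[_ //].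
have ne1 : EH :\ a != EH.
  by apply/eqP => /setP /(_ a); rewrite !inE eqxx aE.
have ek : (e < k)%N.
  have := sbal _ _ sub1 ne1; rewrite /density -/m -/k -/e.
  rewrite ltr_pdivrMr ?ltr0n // mulrAC ltr_pdivlMr ?ltr0n // -!natrM ltr_nat.
  have : e = #|EH :\ a|.+1 by rewrite /e (cardsD1 a) aE.
  set e' := #|EH :\ a| => eE; rewrite eE => h.
  have E x y : (x * y.+1 < x.+1 * y)%N -> (x < y)%N.
    by rewrite mulnS mulSn ltn_add2r.
  rewrite -(prednK k0) ltnS; apply: E; rewrite prednK //.
  by apply: leq_trans h _; rewrite leq_mul2l -ltnS prednK // mk1 orbT.
have ekR : e%:R + 1 <= k%:R :> R by rewrite natr1 ler_nat.
have h1 := ler_wpM2l (ler0n R e) qi.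
have h2 := ler_wpM2r (ltW l0) ekR.
have h3 : d * (l / 2) <= 4^-1 * (l / 2) by rewrite ler_wpM2r ?d4 // divr_ge0 // ltW.
have h4 : 0 <= e%:R * l by rewrite mulr_ge0 // ltW.
move: sg2 h1 h2 h3 h4 l0; rewrite sgE; lra.
Qed.


End Extension.
End Cases.

(** * The theorem *)

Section CompleteGraph.
Variables (n : nat).

Lemma codeg_complete (u v : 'I_n) : u != v -> codeg (complete_graph n) u v = (n - 2)%N.
Proof.
move=> uv; rewrite /codeg.
have -> : [set w | ([set u; w] \in complete_graph n) && ([set v; w] \in complete_graph n)]
    = ~: [set u; v].
  apply/setP => w; rewrite !inE !cards2 !eqSS negb_or (eq_sym w u) (eq_sym w v).
  by case: (u != w); case: (v != w).
by rewrite cardsCs finset.setCK cards2 uv card_ord.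
Qed.

Lemma numtri_complete : numtri (complete_graph n) = 'C(n, 3).
Proof.
rewrite /numtri -[n in RHS]card_ord -card_draws; apply: eq_card => T; rewrite !inE.
apply: andb_idr => _; apply/forallP => a; apply/implyP => /andP[_ a2].
by rewrite inE.
Qed.

Variables (R : realType) (C : R).
Let l : R := ln n%:R.
Hypotheses (n6 : (6 <= n)%N) (l1 : 1 <= l) (Cl : 3 <= C * l).

(** [before_tau] says nothing about time [0], so the start is checked by hand. *)
Lemma regular_complete : regular C 0 (complete_graph n).
Proof.
have n0 : (0 < n)%N by exact: leq_trans n6.
have nR : 0 < n%:R :> R by rewrite ltr0n.
have s0 : 0 < Num.sqrt n%:R :> R by rewrite sqrtr_gt0.
have nsq : Num.sqrt n%:R ^+ 2 = n%:R :> R by rewrite sqr_sqrtr.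
have l0 : 0 < l by rewrite (lt_le_trans ltr01).
have zE : zeta R n 0 = l / Num.sqrt n%:R by rewrite /zeta pp0 mulr1.
have sn : Num.sqrt n%:R <= n%:R :> R.
  by rewrite -[leRHS]nsq expr2 ler_peMr ?(ltW s0) // -[leLHS]sqrtr1 ler_wsqrtr // ler1n.
have n6R : 6 <= n%:R :> R by rewrite ler_nat.
split=> [u v uv|].
  rewrite codeg_complete // pp0 expr1n mulr1 natrB ?(leq_trans _ n6) // zE.
  have -> : (n%:R - 2) / n%:R - 1 = - (2 / n%:R) :> R by field; rewrite gt_eqF.
  rewrite normrN ger0_norm ?divr_ge0 // mulrA.
  apply: ler_pM; rewrite ?invr_ge0 ?ler0n //; first by move: Cl; lra.
  by rewrite lef_pV2 ?posrE.
rewrite numtri_complete pp0 expr1n mulr1 zE expr_div_n nsq.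
have bE : 'C(n, 3)%:R = n%:R * (n%:R - 1) * (n%:R - 2) / 6 :> R.
  have h : ('C(n, 3) * 6 = n * (n - 1) * (n - 2))%N.
    by rewrite (bin_ffact n 3) !ffactnS ffactn0 muln1 mulnA subn1 subn2.
  have := congr1 (fun k : nat => k%:R : R) h; rewrite /= !natrM !natrB ?(leq_trans _ n6) //.
  by move=> <-; rewrite mulfK.
have -> : 'C(n, 3)%:R / (6^-1 * n%:R ^+ 3) - 1 = - (3 - 2 / n%:R) / n%:R :> R.
  by rewrite bE; field; rewrite gt_eqF.
rewrite mulNr normrN ger0_norm; last first.
  rewrite divr_ge0 // subr_ge0 ler_pdivrMr //; move: n6R; lra.
rewrite mulrA; apply: ler_pM; rewrite ?invr_ge0 ?ler0n //.
  rewrite subr_ge0 ler_pdivrMr //; move: n6R; lra.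
apply: (@le_trans _ _ 3); first by rewrite lerBlDr lerDl divr_ge0.
apply: (le_trans Cl); rewrite expr2 mulrA ler_peMr // (le_trans _ Cl) //.
Qed.

End CompleteGraph.

(** Goodness is known only strictly before the current step; the bounds on [p] and [zeta] at that
    step follow from the previous one with a factor [2] to spare. *)
Lemma zeta_next (R : realType) n j (b : R) : (6 <= n)%N -> 1 <= ln n%:R :> R ->
  1 <= b -> 0 < pp R n j -> zeta R n j * (2 * b) <= 1 ->
  0 < pp R n j.+1 /\ zeta R n j.+1 * b <= 1.
Proof.
move=> n6 l1 b1 p0 zb; have n0 : (0 < n)%N by exact: leq_trans n6.
have z0 := zeta_gt0 n0 l1 p0; have x0 := rate_gt0 n0 p0.
have z2 : zeta R n j <= 2^-1.
  have : zeta R n j * 2 <= zeta R n j * (2 * b).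
    by rewrite ler_wpM2l ?(ltW z0) // ler_peMr.
  by move: zb; lra.
have x2 : rate R n j <= 2^-1.
  apply: (le_trans _ z2); apply: rate_le_zeta => //; move: z2; lra.
have p1 : 0 < pp R n j.+1 by rewrite ppS // mulr_gt0 // subr_gt0; move: x2; lra.
split=> //; rewrite zetaS // mulrAC ler_pdivrMr ?mul1r; last by move: x2; lra.
by move: zb x2; rewrite mulrCA; move: (_ * b) => y; lra.
Qed.

Lemma prob_and (R : realType) n (D : Prop) (E : seq (graph n) -> Prop) (q : R) :
  0 <= q -> (D -> Prob E <= q) -> Prob (fun s => D /\ E s) <= q.
Proof.
move=> q0 DE; have [Dp|nD] := pselect D.
  by apply: le_trans (DE Dp); apply: traj_prob_mono => s [].
by rewrite /Prob traj_prob0 // => s [].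
Qed.

(** * Failure events and the final union bound *)

Section Main.
Variables (R : realType) (C : R) (omega : nat -> R) (N n : nat).
Hypotheses (C0 : 0 < C) (N0 : (0 < N)%N).
Let d := root_delta R N.
Let l : R := ln n%:R.
Let M := log_power N.
Hypotheses (n6 : (6 <= n)%N) (l2 : 2 <= l) (lz : 16 * zeta_const C N <= l).
Hypotheses (ll : log_const C N <= l) (Cl : 3 <= C * l).
Hypothesis om : M.+1%:R <= omega n.
Hypothesis sq : 2 * l ^+ M.+1 <= Num.sqrt n%:R.

Let n0 : (0 < n)%N. Proof. exact: leq_trans n6. Qed.
Let nR : 0 < n%:R :> R. Proof. by rewrite ltr0n. Qed.
Let l1 : 1 <= l. Proof. by move: l2; lra. Qed.
Let l0 : 0 < l. Proof. by move: l2; lra. Qed.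

Definition admissible i := 0 < pp R n i /\ zeta R n i * l ^+ M <= 1.

Let zeta_double j : zeta R n j * l ^+ M.+1 <= 1 -> 0 < pp R n j ->
  zeta R n j * (2 * l ^+ M) <= 1.
Proof.
move=> h p0; apply: le_trans h; rewrite exprS ler_wpM2l ?(ltW (zeta_gt0 n0 l1 p0)) //.
by rewrite ler_wpM2r // exprn_ge0 // ltW.
Qed.

Lemma before_tau_regular s i : before_tau C omega (complete_graph n :: s) i ->
  (forall j, (j < i)%N -> regular C j (nth (complete_graph n) (complete_graph n :: s) j))
  /\ admissible i.
Proof.
move=> bt; have lM : 1 <= l ^+ M by rewrite exprn_ege1.
have s0 : 0 < Num.sqrt n%:R :> R by rewrite sqrtr_gt0.
have zero : zeta R n 0 * (2 * l ^+ M) <= 1.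
  rewrite /zeta pp0 mulr1 mulrAC ler_pdivrMr // mul1r.
  by apply: le_trans sq; rewrite mulrCA -exprS.
split=> [[|j] ji|].
- exact: regular_complete.
- have [_ cd tr _] := bt j.+1 isT ji; by split=> [u v uv|]; apply: ltW; [exact: cd | exact: tr].
have zeta_prev j : (j < i)%N -> 0 < pp R n j /\ zeta R n j * (2 * l ^+ M) <= 1.
  case: j => [|j] ji; first by rewrite pp0.
  have [_ _ _ [p0 wj]] := bt j.+1 isT ji; split=> //; apply: zeta_double => //.
  have z0 := zeta_gt0 n0 l1 p0.
  have lnl : 0 < ln l by rewrite ln_gt0 //; move: l2; lra.
  (* [omega n >= M + 1] becomes [zeta <= l ^ -(M + 1)]; the additional logarithm supplies the factor
     [2] wanted by [zeta_next]. *)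
  have := le_trans om wj; rewrite ler_pdivlMr // mulr_natl -lnXn // ler_ln ?posrE ?exprn_gt0 ?invr_gt0 //.
  by rewrite -[_^-1]mul1r ler_pdivlMr // mulrC.
case: i bt zeta_prev => [|i] _ zp.
  split; first by rewrite pp0.
  apply: le_trans zero; rewrite ler_wpM2l ?ler_peMl ?exprn_ge0 ?ler1n ?(ltW l0) //.
  by rewrite ltW // zeta_gt0 // pp0.
by have [p0 z2] := zp i (ltnSn i); exact: zeta_next.
Qed.

Lemma admissible_cube i : admissible i -> zeta R n i * l ^+ 3 <= 1.
Proof.
move=> [p0 h]; apply: le_trans h; rewrite ler_wpM2l ?(ltW (zeta_gt0 n0 l1 p0)) //.
rewrite ler_weXn2l // /M /log_power (leq_trans _ (leq_pmulr _ _)) ?expn_gt0 ?addn_gt0 ?N0 //.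
by rewrite (leq_trans _ (leq_pmulr _ _)) ?addn_gt0 ?N0 // (leq_trans _ (leq_pmulr _ _)).
Qed.

Definition few_extensions v (EH : {set {set 'I_v}}) j (G : graph n) : Prop :=
  forall J phi, (Psi EH J phi G)%:R <=
    expR 1 * ext_bound n EH J (moment_radius R N n) (pp R n j).

Definition tracked v (EH : {set {set 'I_v}}) i (s : seq (graph n)) : Prop :=
  forall j, (j < i)%N -> regular C j (nth (complete_graph n) s j) /\
    few_extensions EH j (nth (complete_graph n) s j).

(** Deterministic side conditions are part of the bad events, so the union can run over all indices
    while tails are estimated only where those conditions hold. *)
Let bad_count i v (EH : {set {set 'I_v}}) J phi (s : seq (graph n)) : Prop :=
  (admissible i /\ forall a, a \in EH -> #|a| = 2%N) /\
  (forall j, (j < i)%N -> regular C j (nth (complete_graph n) s j)) /\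
  expR 1 * ext_bound n EH J (moment_radius R N n) (pp R n i) <=
    (Psi EH J phi (nth (complete_graph n) s i))%:R.

Let S v (EH : {set {set 'I_v}}) (IH : {set 'I_v}) := scaling (R := R) n EH IH.

Let eps1 i := powR (zeta R n i) (d ^+ 2).
Let eps2 v (EH : {set {set 'I_v}}) (IH : {set 'I_v}) i :=
  powR (S EH IH i) (- d) * powR l (3 * expR (v - #|IH|)%N%:R).

Let early v (EH : {set {set 'I_v}}) (IH : {set 'I_v}) j :=
  0 < pp R n j /\ S EH IH j <= powR (zeta R n j) (- d).

Let bad_dev1 i v (EH : {set {set 'I_v}}) IH (phi : 'I_v -> 'I_n) (s : seq (graph n)) : Prop :=
  [/\ admissible i, is_ext EH IH, {in IH &, injective phi},
     balanced (R := R) EH IH & le_tmin i (early EH IH)] /\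
  tracked EH i s /\
  eps1 i < `|(Psi EH IH phi (nth (complete_graph n) s i))%:R / S EH IH i - 1|.

Let bad_dev2 i v (EH : {set {set 'I_v}}) IH (phi : 'I_v -> 'I_n) (s : seq (graph n)) : Prop :=
  [/\ admissible i, is_ext EH IH, {in IH &, injective phi} &
     [/\ strictly_balanced (R := R) EH IH, ge_tmin i (early EH IH) &
         le_tmin i (fun j => 0 < pp R n j /\ S EH IH j <= 1)]] /\
  tracked EH i s /\
  eps2 EH IH i < `|(Psi EH IH phi (nth (complete_graph n) s i))%:R / S EH IH i - 1|.

Let q : R := expR (- (tail_exp R N * l)).
Let q0 : 0 <= q. Proof. exact: expR_ge0. Qed.

Let prob_bad_count i v (EH : {set {set 'I_v}}) J phi :
  (i <= n ^ 2)%N -> (v <= N)%N -> Prob (bad_count i EH J phi) <= 2 * q.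
Proof.
move=> in2 vN; apply: prob_and; first exact: mulr_ge0.
move=> [num E2]; have z3 := admissible_cube num; case: num => p0 _.
apply: le_trans (Psi_upper_tail C0 n6 l1 lz in2 p0 z3 vN E2 J phi) _.
by rewrite ler_peMl // ler1n.
Qed.

Let prob_bad_dev1 i v (EH : {set {set 'I_v}}) IH phi :
  (i <= n ^ 2)%N -> (v <= N)%N -> Prob (bad_dev1 i EH IH phi) <= 2 * q.
Proof.
move=> in2 vN; apply: prob_and; first exact: mulr_ge0.
move=> [num ext inj bal early_i]; have z3 := admissible_cube num; case: num => p0 zM.
have E2 : forall a, a \in EH -> #|a| = 2%N by case: ext.
have [e0 s0 h1 h2 h3] := balanced_conditions C0 N0 n6 l2 lz p0 zM vN ext bal early_i.
exact: (deviation_tail C0 n6 l1 lz ll in2 p0 z3 vN E2 inj e0 s0 h1 h2 h3).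
Qed.

Let prob_bad_dev2 i v (EH : {set {set 'I_v}}) IH phi :
  (i <= n ^ 2)%N -> (v <= N)%N -> Prob (bad_dev2 i EH IH phi) <= 2 * q.
Proof.
move=> in2 vN; apply: prob_and; first exact: mulr_ge0.
move=> [num ext inj [sbal late early_i]]; have z3 := admissible_cube num; case: num => p0 zM.
have E2 : forall a, a \in EH -> #|a| = 2%N by case: ext.
have [e0 s0 h1 h2 h3] :=
  strictly_balanced_conditions C0 N0 n6 l2 lz p0 zM vN ext sbal late early_i.
exact: (deviation_tail C0 n6 l1 lz ll in2 p0 z3 vN E2 inj e0 s0 h1 h2 h3).
Qed.

Lemma prob_extensions (L : R) : L <= N%:R ->
  1 - 6 * union_const R N / n%:R ^+ 2 <= Prob (R := R) (fun s : seq (graph n) =>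
    forall i : nat, (i <= n ^ 2)%N -> before_tau C omega s i ->
       forall (v : nat) (EH : {set {set 'I_v}}) (IH : {set 'I_v}) (phi : 'I_v -> 'I_n),
         v%:R <= L -> is_ext EH IH -> {in IH &, injective phi} ->
         let G := nth (complete_graph n) s i in
         let SH := scaling (R := R) n EH IH in
         let z := zeta R n in
         (balanced (R := R) EH IH ->
            le_tmin i (fun j => 0 < pp R n j /\ SH j <= powR (z j) (- d)) ->
            `| (Psi EH IH phi G)%:R - SH i | <= SH i * powR (z i) (d ^+ 2))
         /\
         (strictly_balanced (R := R) EH IH ->
            ge_tmin i (fun j => 0 < pp R n j /\ SH j <= powR (z j) (- d)) ->
            le_tmin i (fun j => 0 < pp R n j /\ SH j <= 1) ->
            `| (Psi EH IH phi G)%:R - SH i |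
              <= powR (SH i) (1 - d) * powR (ln n%:R) (3 * expR (v - #|IH|)%N%:R))).
Proof.
move=> LN; set good_event := (X in _ <= Prob X).
have q20 : 0 <= 2 * q by exact: mulr_ge0.
have B1 := prob_some_extension n0 q20 prob_bad_count.
have B2 := prob_some_extension n0 q20 prob_bad_dev1.
have B3 := prob_some_extension n0 q20 prob_bad_dev2.
set T := union_const R N * n%:R ^+ (N + 2) * (2 * q) in B1 B2 B3.
(* Three such families of failures give the [6] in the statement. *)
have TE : T = 2 * union_const R N / n%:R ^+ 2.
  have qE : q = (n%:R ^+ (N + 2) * n%:R ^+ 2)^-1.
    rewrite /q expRN -exprD -addnA /tail_exp -natrD expRM_natl lnK ?posrE //.
  have E (a b c : R) : b != 0 -> c != 0 -> a * b * (2 * (b * c)^-1) = 2 * a / c.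
    by move=> b0 c0; field; rewrite b0 c0.
  by rewrite /T qE E // expf_neq0 // gt_eqF.
suff : 1 <= Prob (R := R) good_event + (T + (T + T)) by rewrite TE; lra.
pose bad s := some_extension N bad_count s \/
  (some_extension N bad_dev1 s \/ some_extension N bad_dev2 s).
have bad_le : Prob (R := R) bad <= T + (T + T).
  apply: le_trans (traj_prob_or _ _ _ _ _) (lerD B1 _).
  exact: le_trans (traj_prob_or _ _ _ _ _) (lerD B2 B3).
apply: (@le_trans _ _ (Prob (R := R) good_event + Prob bad)); last by rewrite lerD2l.
apply: le_trans (traj_prob_or _ _ _ _ _).
rewrite traj_probT // => s'; set s := _ :: s'.
have [|ok1] := pselect (some_extension N bad_count s); first by right; left.
have [|ok2] := pselect (some_extension N bad_dev1 s); first by right; right; left.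
have [|ok3] := pselect (some_extension N bad_dev2 s); first by right; right; right.
left=> i in2 bt v EH IH phi vL ext inj G SH z.
have vN : (v < N.+1)%N by rewrite ltnS -(ler_nat R) (le_trans vL).
have iN : (i < (n ^ 2).+1)%N by rewrite ltnS.
have [reg num] := before_tau_regular bt.
have ffunK (phi' : 'I_v -> 'I_n) : [ffun a => phi' a] = phi' :> ('I_v -> 'I_n).
  by apply/funext => a; rewrite ffunE.
(* An excessive count at some [j < i] would be a [bad_count] at time [j], whose requirements at [j]
   follow from those at [i] by monotonicity of [zeta]. *)
have tr : tracked EH i s.
  move=> j ji; split; first exact: reg.
  move=> J phi'; rewrite leNgt; apply/negP => many; apply: ok1.
  have jN : (j < (n ^ 2).+1)%N by rewrite ltnS (leq_trans (ltnW ji)).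
  exists (Ordinal jN), (Ordinal vN), EH, J, [ffun a => phi' a]; rewrite ffunK.
  have [pi0 zi] := num; have pj0 := lt_le_trans pi0 (pp_anti R n (ltnW ji)).
  split; last by split; [move=> j' jj; apply: reg; exact: ltn_trans ji | exact: ltW].
  split; last by case: ext.
  split=> //; apply: le_trans zi; rewrite ler_wpM2r ?exprn_ge0 ?(ltW l0) //.
  exact: (zeta_mono n0 l1 (ltnW ji)).
have S0 : 0 < SH i by rewrite mulr_gt0 ?exprn_gt0 //; case: num.
have rel (x eps : R) : x / SH i - 1 <= eps /\ - eps <= x / SH i - 1 ->
    `|x - SH i| <= SH i * eps.
  move=> [h1 h2]; have -> : x - SH i = SH i * (x / SH i - 1) by field; rewrite gt_eqF.
  rewrite normrM gtr0_norm // ler_wpM2l ?(ltW S0) // ler_norml h1 h2 //.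
have rel' x eps : `|x / SH i - 1| <= eps -> `|x - SH i| <= SH i * eps.
  by rewrite ler_norml => /andP[h1 h2]; apply: rel.
split=> [bal early_i|sbal late early_i].
  apply: rel'; rewrite leNgt; apply/negP => dev; apply: ok2.
  by exists (Ordinal iN), (Ordinal vN), EH, IH, [ffun a => phi a]; rewrite ffunK.
rewrite (_ : powR (SH i) (1 - d) * _ = SH i * eps2 EH IH i); last first.
  rewrite /eps2 mulrA; congr (_ * _).
  by rewrite powRD ?(gt_eqF S0) ?implybT // powRr1 // ltW.
apply: rel'; rewrite leNgt; apply/negP => dev; apply: ok3.
by exists (Ordinal iN), (Ordinal vN), EH, IH, [ffun a => phi a]; rewrite ffunK.
Qed.

End Main.

Local Open Scope classical_set_scope.
Local Open Scope ring_scope.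

Lemma near_ln_ge (R : realType) (a : R) : \forall n \near \oo, a <= ln n%:R.
Proof.
near=> n; rewrite -ler_expR lnK ?posrE; last by near: n; exact: nbhs_infty_gtr.
by near: n; exact: nbhs_infty_ger.
Unshelve. all: by end_near. Qed.

(* With [l = ln n], [sqrt n = exp (l/2)] beats every power of [l]. *)
Lemma near_ln_expn_le_sqrt (R : realType) (m : nat) :
  \forall n \near \oo, 2 * ln n%:R ^+ m <= Num.sqrt n%:R :> R.
Proof.
pose b : R := 2 * m.+1%:R; pose c := 2 * b ^+ m.+1.
near=> n.
have n0 : 0 < n%:R :> R by near: n; exact: nbhs_infty_gtr.
have cl : c <= ln n%:R by near: n; exact: near_ln_ge.
set l : R := ln n%:R in cl *.
have b0 : 0 < b by rewrite mulr_gt0.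
have c0 : 0 < c by rewrite mulr_gt0 // exprn_gt0.
have l0 : 0 < l by exact: lt_le_trans cl.
have sE : Num.sqrt n%:R = expR (l / b) ^+ m.+1.
  have nE : n%:R = (expR (l / b) ^+ m.+1) ^+ 2.
    rewrite -exprM -expRM_natl natrM -/l [_ * 2]mulrC -/b mulrC divfK ?gt_eqF //.
    by rewrite /l lnK ?posrE.
  by rewrite nE sqrtr_sqr ger0_norm // exprn_ge0 // expR_ge0.
rewrite sE; apply: (@le_trans _ _ ((l / b) ^+ m.+1)); last first.
  rewrite lerXn2r ?nnegrE ?expR_ge0 ?divr_ge0 ?ltW //.
  by apply: lt_le_trans (expR_ge1Dx _); rewrite ltrDr.
rewrite expr_div_n ler_pdivlMr ?exprn_gt0 // [leRHS]exprS mulrAC.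
by rewrite ler_wpM2r // exprn_ge0 // ltW.
Unshelve. all: by end_near. Qed.

Theorem theorem3p2 (R : realType) (C : R) (omega : nat -> R) :
  0 < C ->
  omega @ \oo --> +oo ->
  forall L : R, 0 < L ->
  exists delta : R, 0 < delta /\ delta < 1 /\
    whp (R := R) (fun (n : nat) (s : seq (graph n)) =>
       forall i : nat, (i <= n ^ 2)%N -> before_tau C omega s i ->
       forall (v : nat) (EH : {set {set 'I_v}}) (IH : {set 'I_v}) (phi : 'I_v -> 'I_n),
         v%:R <= L -> is_ext EH IH -> {in IH &, injective phi} ->
         let G := nth (complete_graph n) s i in
         let SH := scaling (R := R) n EH IH in
         let z := zeta R n in
         (* (i) *)
         (balanced (R := R) EH IH ->
            le_tmin i (fun j => 0 < pp R n j /\ SH j <= powR (z j) (- Num.sqrt delta)) ->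
            `| (Psi EH IH phi G)%:R - SH i | <= SH i * powR (z i) delta)
         /\
         (* (ii) *)
         (strictly_balanced (R := R) EH IH ->
            ge_tmin i (fun j => 0 < pp R n j /\ SH j <= powR (z j) (- Num.sqrt delta)) ->
            le_tmin i (fun j => 0 < pp R n j /\ SH j <= 1) ->
            `| (Psi EH IH phi G)%:R - SH i |
              <= powR (SH i) (1 - Num.sqrt delta)
                 * powR (ln n%:R) (3 * expR (v - #|IH|)%N%:R))).
Proof.
move=> C0 om L L0.
pose N := (Num.truncn L).+1.
have LN : L <= N%:R by rewrite ltW // truncnS_gt.
have cube1 : 1 <= (N%:R + 2) ^+ 3 :> R.
  by rewrite exprn_ege1 // (@le_trans _ _ 2) ?ler1n ?lerDr.
have d0 : 0 < root_delta R N by rewrite invr_gt0 mulr_gt0 // (lt_le_trans ltr01).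
have d1 : root_delta R N < 1.
  rewrite invf_lt1 ?mulr_gt0 // ?(lt_le_trans ltr01) //; by move: cube1; move: (_ ^+ 3) => y; lra.
(* A square, so that [Num.sqrt delta] is the exponent used so far. *)
exists (root_delta R N ^+ 2); split; first by rewrite exprn_gt0.
split; first by rewrite exprn_ilt1 // ltW.
rewrite sqrtr_sqr gtr0_norm //.
apply/cvgrPdist_le => eps eps0; near=> n.
have n0 : 0 < n%:R :> R by near: n; exact: nbhs_infty_gtr.
have lower : 1 - 6 * union_const R N / n%:R ^+ 2 <= _ :=
  prob_extensions C0 (ltn0Sn _) _ _ _ _ _ _ _ LN.
rewrite ger0_norm ?subr_ge0 ?traj_prob_le1 // lerBlDr -lerBlDl.
apply: le_trans (lower _ _ _ _ _ _ _ _).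
- rewrite lerD2l lerN2 ler_pdivrMr ?exprn_gt0 //.
  have nK : 6 * union_const R N / eps <= n%:R by near: n; exact: nbhs_infty_ger.
  rewrite -ler_pdivrMl // mulrC; apply: (le_trans nK).
  by rewrite expr2 ler_peMr ?ler0n // ler1n -(ltr0n R).
- by near: n; exact: nbhs_infty_ge.
- by near: n; exact: near_ln_ge.
- by near: n; exact: near_ln_ge.
- by near: n; exact: near_ln_ge.
- rewrite mulrC -ler_pdivrMr //; near: n; exact: near_ln_ge.
- near: n; move/cvgryPge: om; exact.
- by near: n; exact: near_ln_expn_le_sqrt.
Unshelve. all: by end_near. Qed.
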